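(* For all sufficiently large $n$ let $m=m_n$, $r=r_n$, $k=k_n$ be positive integers with $r,m\le n/2$ and $k\le m$, and suppose that $\lim_{n\to\infty}k/n=\gamma$, $\lim_{n\to\infty}m/n=h$, $\lim_{n\to\infty}r/n=\eta$, where $0<\gamma\le h\le\frac12$, $0<\eta\le\frac12$, $\gamma\ne h(1-h)$, and $\gamma\neq\frac12$ if $h=\frac12$. Let $\{X^{(n)}_t\}_n$ be the corresponding sequence of generalized Bernoulli-Laplace chains with parameters $(n,m,r,k)$, let $t^{(n)}_{\mathrm{mix}}(\varepsilon)$ be their mixing times, and set $$t_n=\frac{\log n}{2\left|\log\left|1-\frac{kn}{m(n-m)}\right|\right|}.$$ Then for every $\varepsilon\in(0,1)$ there exist constants $N_1,N_2,c,C$ (depending on $\varepsilon,\gamma,\eta,h$) such that for all $n\ge N_1$, $$t_n-c\le t^{(n)}_{\mathrm{mix}}(\varepsilon),$$ and for all $n\ge N_2$, $$t^{(n)}_{\mathrm{mix}}(\varepsilon)\le t_n+C.$$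
   Context: Generalized Bernoulli-Laplace chain with parameters $(n,m,r,k)$: there are $n$ balls, $r$ red and $n-r$ white; the left urn holds $m$ balls and the right urn holds $n-m$ balls. At each time step, $k$ balls are chosen uniformly at random without replacement from each urn (independently) and swapped. $X_t$ is the number of red balls in the left urn after $t$ swaps. It is a Markov chain on $\mathcal X=\{0,1,\dots,\min(m,r)\}$ (as $r,m\le n/2$) with transition probabilities $p(x,y)=\mathbb P(x-H_1^x+H_2^x=y)$, where $H_1^x\sim\mathrm{Hyp}(m,x,k)$ and $H_2^x\sim\mathrm{Hyp}(n-m,r-x,k)$ are independent; $\mathrm{Hyp}(N,K,s)$ is the number of marked items among $s$ items drawn without replacement from $N$ items of which $K$ are marked. Let $P$ be the transition kernel and $\pi$ the stationary distribution, $\pi(j)=\binom rj\binom{n-r}{m-j}/\binom nm$. Total variation distance is $\|\mu-\nu\|_{TV}=\sup_{A\subset\mathcal X}|\mu(A)-\nu(A)|$, and $$t^{(n)}_{\mathrm{mix}}(\varepsilon)=\sup_{x\in\mathcal X}\inf\{t:\|\delta_xP^t-\pi\|_{TV}\le\varepsilon\},$$ with $\delta_x$ the point mass at $x$. Under the assumptions $t_n$ is well defined for all large $n$. *)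

(* Defs.v *)
From mathcomp Require Import all_boot all_order all_algebra.
From mathcomp Require Import all_classical all_reals all_analysis.

Set Implicit Arguments.
Unset Strict Implicit.
Unset Printing Implicit Defensive.

Import Order.TTheory GRing.Theory Num.Theory.
Import numFieldNormedType.Exports.

Local Open Scope classical_set_scope.
Local Open Scope ring_scope.

(* Law of Hyp(N, K, s): the items are 'I_N, those with index less than K are
   marked, and a uniformly random s-subset A is drawn. *)
Definition hyp_pmf (R : realType) (N K s i : nat) : R :=
  #|[set A : {set 'I_N} |
      (#|A| == s) && (#|[set a in A | (a < K)%N]%SET| == i)]%SET|%:R
  / #|[set A : {set 'I_N} | #|A| == s]%SET|%:R.

Lemma hyp_pmfE (R : realType) (N K s i : nat) :
  (K <= N)%N -> (i <= s)%N ->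
  hyp_pmf R N K s i = ('C(K, i) * 'C(N - K, s - i))%:R / 'C(N, s)%:R.
Proof.
move=> KN iS; rewrite /hyp_pmf.
have cD (B : {set 'I_N}) (j : nat) :
    #|[set A : {set 'I_N} | (A \subset B) && (#|A| == j)]%SET| = 'C(#|B|, j).
  exact: cards_draws.
have -> : #|[set A : {set 'I_N} | #|A| == s]%SET| = 'C(N, s).
  by rewrite card_draws card_ord.
congr (_%:R / _).
pose M : {set 'I_N} := [set a : 'I_N | (a < K)%N]%SET.
have cM : #|M| = K.
  by rewrite -sum1dep_card (big_ord_narrow KN) sum1_card card_ord.
have cMC : #|~: M| = (N - K)%N by rewrite cardsCs finset.setCK cM card_ord.
rewrite -{2}cM -cMC -!cD -cardsX.
pose f (A : {set 'I_N}) := (A :&: M, A :&: ~: M)%SET.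
have f_inj : injective f.
  move=> A B [e1 e2]; rewrite -(finset.setID A M) -(finset.setID B M).
  by rewrite !finset.setDE e1 e2.
rewrite -(card_imset _ f_inj); apply: eq_card => -[U V].
have seteq (A : {set 'I_N}) : [set a in A | (a < K)%N]%SET = (A :&: M)%SET.
  by apply/finset.setP => a; rewrite !inE.
apply/imsetP/idP => [[A + [-> ->]]|].
  rewrite !inE seteq => /andP[/eqP As /eqP Ai].
  rewrite /= !finset.subsetIr Ai eqxx /= -finset.setDE cardsD Ai As.
  by rewrite eqxx.
rewrite !inE /= => /andP[/andP[UM /eqP cU] /andP[VM /eqP cV]].
have VM0 : (V :&: M = finset.set0)%SET.
  by apply/eqP; rewrite setI_eq0 finset.disjoints_subset.
have UM0 : (U :&: ~: M = finset.set0)%SET.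
  by apply/eqP; rewrite setI_eq0 finset.disjoints_subset finset.setCK.
have UV1 : ((U :|: V) :&: M = U)%SET.
  by rewrite finset.setIUl VM0 finset.setU0; apply/finset.setIidPl.
have UV2 : ((U :|: V) :&: ~: M = V)%SET.
  by rewrite finset.setIUl UM0 finset.set0U; apply/finset.setIidPl.
exists (U :|: V)%SET; last by rewrite /f UV1 UV2.
rewrite inE seteq UV1 cU eqxx andbT.
by rewrite -(cardsID M) UV1 finset.setDE UV2 cU cV subnKC.
Qed.


(* The state space is {0, ..., min(m, r)}, which presupposes m + r <= n.
   p(x, y) = P(x - H1 + H2 = y) for independent H1 ~ Hyp(m, x, k) and
   H2 ~ Hyp(n - m, r - x, k); the event is written x + H2 = y + H1 because
   subtraction on nat is truncated. *)
Definition bl_kernel (R : realType) (n m r k : nat) : 'M[R]_((minn m r).+1) :=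
  \matrix_(x, y) \sum_(i < k.+1) \sum_(j < k.+1 | (x + j == y + i)%N)
    hyp_pmf R m x k i * hyp_pmf R (n - m) (r - x) k j.

Definition bl_stationary (R : realType) (n m r : nat) :
    'rV[R]_((minn m r).+1) :=
  \row_j (('C(r, j) * 'C(n - r, m - j))%:R / 'C(n, m)%:R).

Definition tv_dist (R : realType) (N : nat) (mu nu : 'rV[R]_N) : R :=
  sup (range (fun A : {set 'I_N} =>
    `| \sum_(x in A) mu 0 x - \sum_(x in A) nu 0 x |)).

(* Extended-real valued, so that the infimum over an empty set of times
   is +oo. *)
Definition bl_mixing_time (R : realType) (n m r k : nat) (eps : R) : \bar R :=
  ereal_sup (range (fun x : 'I_(minn m r).+1 =>
    ereal_inf [set t%:R%:E | t in [set t : nat |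
      tv_dist (delta_mx 0 x *m bl_kernel R n m r k ^+ t)
              (bl_stationary R n m r) <= eps]])).

Definition bl_cutoff_time (R : realType) (n m k : nat) : R :=
  ln n%:R /
  (2 * `| ln `| 1 - (k%:R * n%:R) / (m%:R * (n%:R - m%:R)) | |).

(* Main.v *)
(** Let P be the transition operator, p = k/m, q = k/(n-m), Df(z) = f(z+1) - f(z).
    Splitting off one distinguished ball in each urn, red in one configuration
    and white in the other, gives
      D(Pf)(x) = (1-p)(1-q) E Df(Y'') - pq E Df(Y')
    for suitable random variables Y', Y''.  Hence P shrinks Lipschitz constants
    by a factor rho = (1-p)(1-q) + pq < 1, while means contract by the smaller
    factor lambda = 1 - p - q.  A Stein identity for the hypergeometric law shows
    that, for |f| <= 1, Pf is O(1/sqrt n)-Lipschitz in the bulk of the state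
    space; as one step leads to the bulk with high probability from every state,
    P^2 f is O(1/sqrt n)-Lipschitz everywhere.
    Upper bound: at time t_n the chain is at mean square distance O(sqrt n) from
    mr/n, and so is the stationary law; s+2 further steps therefore bring the
    total variation distance down to O(rho^s), with s depending on epsilon only.
    Lower bound: by Chebyshev's inequality, as the mean of the chain started at 0
    is at time t_n - c still at a large multiple of sqrt n from mr/n. *)
Require Import Defs.
From mathcomp Require Import all_boot all_order all_algebra.
From mathcomp Require Import all_classical all_reals all_analysis.
From mathcomp Require Import ring lra zify.

Set Implicit Arguments.
Unset Strict Implicit.
Unset Printing Implicit Defensive.

Import Order.TTheory GRing.Theory Num.Theory.
Import numFieldNormedType.Exports.

Local Open Scope classical_set_scope.
Local Open Scope ring_scope.

(** * Hypergeometric laws *)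

(* K marked items, L unmarked items, s draws. *)
Definition hyp (R : realType) (K L s i : nat) : R :=
  if (i <= s)%N then ('C(K, i) * 'C(L, s - i))%:R / 'C(K + L, s)%:R else 0.

Definition hypE (R : realType) (K L s : nat) (f : nat -> R) : R :=
  \sum_(i < s.+1) hyp R K L s i * f i.

Section Hypergeometric.
Variable R : realType.
Implicit Types (K L s i j : nat) (f g : nat -> R).

Lemma hyp_pmf_hyp (N K s i : nat) : (K <= N)%N -> (i <= s)%N ->
  hyp_pmf R N K s i = hyp R K (N - K) s i.
Proof. by move=> KN is_; rewrite hyp_pmfE // /hyp is_ subnKC. Qed.

Lemma hyp_ge0 K L s i : 0 <= hyp R K L s i.
Proof. by rewrite /hyp; case: ifP => // _; rewrite divr_ge0. Qed.

Lemma hyp_eq0 K L s i :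
  ~~ [&& i <= s, i <= K & s - i <= L]%N -> hyp R K L s i = 0.
Proof.
rewrite /hyp; case: ifP => // is_ /=; rewrite negb_and -!ltnNge.
by case/orP => h; rewrite (bin_small h) ?mul0n ?muln0 mul0r.
Qed.

(** The law vanishes off its support, so functions need only be compared at counts that can
    occur. *)
Lemma eq_hypE K L s f g :
  (forall i, (i <= s)%N -> (i <= K)%N -> (s - i <= L)%N -> f i = g i) ->
  hypE K L s f = hypE K L s g.
Proof.
move=> fg; apply: eq_bigr => i _.
have [/and3P[i1 i2 i3]|/hyp_eq0->] := boolP [&& i <= s, i <= K & s - i <= L]%N.
  by rewrite fg.
by rewrite !mul0r.
Qed.

Lemma le_hypE K L s f g :
  (forall i, (i <= s)%N -> (i <= K)%N -> (s - i <= L)%N -> f i <= g i) ->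
  hypE K L s f <= hypE K L s g.
Proof.
move=> fg; apply: ler_sum => i _.
have [/and3P[i1 i2 i3]|/hyp_eq0->] := boolP [&& i <= s, i <= K & s - i <= L]%N.
  by rewrite ler_wpM2l ?hyp_ge0 ?fg.
by rewrite !mul0r.
Qed.

Lemma hypED K L s f g :
  hypE K L s (fun i => f i + g i) = hypE K L s f + hypE K L s g.
Proof. by rewrite -big_split; apply: eq_bigr => i _; rewrite mulrDr. Qed.

Lemma hypEZ K L s (a : R) f : hypE K L s (fun i => a * f i) = a * hypE K L s f.
Proof. by rewrite mulr_sumr; apply: eq_bigr => i _; rewrite mulrCA. Qed.

Lemma hypEN K L s f : hypE K L s (fun i => - f i) = - hypE K L s f.
Proof.
by rewrite -mulN1r -hypEZ; apply: eq_hypE => i _ _ _; rewrite mulN1r.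
Qed.

Lemma hypEB K L s f g :
  hypE K L s (fun i => f i - g i) = hypE K L s f - hypE K L s g.
Proof. by rewrite hypED hypEN. Qed.

Lemma hypE1 K L s : (s <= K + L)%N -> hypE K L s (fun=> 1) = 1 :> R.
Proof.
move=> sKL; have C0 : 'C(K + L, s)%:R != 0 :> R by rewrite pnatr_eq0 -lt0n bin_gt0.
rewrite -[RHS](divff C0) -{1}binomial.Vandermonde natr_sum mulr_suml.
by apply: eq_bigr => i _; rewrite /hyp -ltnS ltn_ord mulr1.
Qed.

Lemma hypE_cst K L s (a : R) : (s <= K + L)%N -> hypE K L s (fun=> a) = a.
Proof.
move=> sKL; rewrite -[RHS]mulr1 -(hypE1 sKL) -hypEZ.
by apply: eq_hypE => i; rewrite mulr1.
Qed.

(** Here the normaliser ['C(K + L, s)] is 0 and division by 0 gives 0. This default lets upper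
    bounds by a nonnegative [B] hold for any number of draws. *)
Lemma hypE_oversized K L s f : (K + L < s)%N -> hypE K L s f = 0.
Proof.
move=> sKL; rewrite /hypE big1 // => i _.
by rewrite /hyp (bin_small sKL) invr0 mulr0 if_same mul0r.
Qed.

Lemma hypE_ge0 K L s f :
  (forall i, (i <= s)%N -> (i <= K)%N -> (s - i <= L)%N -> 0 <= f i) ->
  0 <= hypE K L s f.
Proof.
move=> f0; have <- : hypE K L s (fun=> 0 : R) = 0.
  by rewrite /hypE big1 // => i _; rewrite mulr0.
exact: le_hypE.
Qed.

Lemma ler_norm_hypE K L s f : `|hypE K L s f| <= hypE K L s (fun i => `|f i|).
Proof.
rewrite (le_trans (ler_norm_sum _ _ _)) //; apply: ler_sum => i _.
by rewrite normrM (ger0_norm (hyp_ge0 _ _ _ _)).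
Qed.

Lemma hypE_le K L s f (B : R) : 0 <= B ->
  (forall i, (i <= s)%N -> (i <= K)%N -> (s - i <= L)%N -> f i <= B) ->
  hypE K L s f <= B.
Proof.
move=> B0 fB; have [sKL|sKL] := leqP s (K + L); last by rewrite hypE_oversized.
by rewrite -[leRHS](hypE_cst B sKL); exact: le_hypE.
Qed.

Lemma norm_hypE_le K L s f (B : R) : 0 <= B ->
  (forall i, (i <= s)%N -> (i <= K)%N -> (s - i <= L)%N -> `|f i| <= B) ->
  `|hypE K L s f| <= B.
Proof. by move=> B0 fB; rewrite (le_trans (ler_norm_hypE _ _ _ _)) ?hypE_le. Qed.

Let div2_eq (a b c d : R) : b != 0 -> c != 0 -> d != 0 ->
  b * c = a * d -> a / b / c = d^-1.
Proof.
move=> b0 c0 d0 e; rewrite -mulrA -invfM e invfM mulrA divff ?mul1r //.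
by apply: contra_neq (mulf_neq0 b0 c0) => a0; rewrite e a0 mul0r.
Qed.

(** The probability that a given item is drawn (in [ratio_bin2], is not drawn) converts the
    normaliser for [N] items into the one for [N.+1]; only Pascal's rule is then left for the
    numerators. *)
Let ratio_bin1 (N s : nat) : (s <= N)%N ->
  (s.+1)%:R / (N.+1)%:R / 'C(N, s)%:R = ('C(N.+1, s.+1)%:R)^-1 :> R.
Proof.
move=> sN; apply: div2_eq; rewrite ?pnatr_eq0 -?lt0n ?bin_gt0 //.
have /(congr1 (fun a => a%:R : R)) := mul_bin_diag N.+1 s.
by rewrite !natrM => e; exact: e.
Qed.

Let ratio_bin2 (N s : nat) : (s <= N)%N ->
  (1 - s%:R / (N.+1)%:R) / 'C(N, s)%:R = ('C(N.+1, s)%:R)^-1 :> R.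
Proof.
move=> sN; have -> : 1 - s%:R / (N.+1)%:R = (N.+1 - s)%:R / (N.+1)%:R :> R.
  by rewrite natrB 1?ltnW // mulrBl divff // pnatr_eq0.
apply: div2_eq; rewrite ?pnatr_eq0 //.
- by rewrite -lt0n bin_gt0.
- by rewrite -lt0n bin_gt0 leqW.
have /(congr1 (fun a => a%:R : R)) := mul_bin_down N.+1 s.
by rewrite !natrM => e; exact: e.
Qed.

(* Condition on whether a distinguished marked item (in [hypE_unmarked], an
   unmarked one) is drawn. *)
Lemma hypE_marked K L s f : (s <= K + L)%N ->
  hypE K.+1 L s.+1 f =
    s.+1%:R / (K + L).+1%:R * hypE K L s (fun i => f i.+1) +
    (1 - s.+1%:R / (K + L).+1%:R) * hypE K L s.+1 f.
Proof.
move=> sKL; set q := _ / _.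
have A i : hyp R K.+1 L s.+1 i.+1 = q * hyp R K L s i + (1 - q) * hyp R K L s.+1 i.+1.
  rewrite /hyp ltnS addSn; case: leqP => is_; last by rewrite !mulr0 addr0.
  (* If all items are drawn, the law with [s.+1] draws on the right is oversized, and its weight
     [1 - q] is 0. *)
  rewrite subSS; have [e|ne] := eqVneq s (K + L)%N.
    rewrite /q e divff ?pnatr_eq0 // subrr mul0r addr0 mul1r !binn -e.
    rewrite binS mulnDl (_ : 'C(K, i.+1) * 'C(L, s - i) = 0)%N ?add0n //.
    have [h|h] := leqP i.+1 K; last by rewrite bin_small.
    by rewrite (@bin_small L) ?muln0 // e; lia.
  have sKL' : (s.+1 <= K + L)%N by rewrite ltn_neqAle ne.
  rewrite [q * _]mulrCA [(1 - q) * _]mulrCA.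
  rewrite ratio_bin1 // ratio_bin2 // -mulrDl -natrD; congr (_%:R / _).
  by rewrite binS mulnDl addnC.
have -> : hypE K.+1 L s.+1 f = hyp R K.+1 L s.+1 0 * f 0%N +
    \sum_(i < s.+1) (q * hyp R K L s i + (1 - q) * hyp R K L s.+1 i.+1) * f i.+1.
  by rewrite /hypE big_ord_recl; congr (_ + _); apply: eq_bigr => i _; rewrite -A.
have -> : hypE K L s.+1 f = hyp R K L s.+1 0 * f 0%N +
    \sum_(i < s.+1) hyp R K L s.+1 i.+1 * f i.+1 by rewrite /hypE big_ord_recl.
rewrite mulrDr.
have -> : hyp R K.+1 L s.+1 0 = (1 - q) * hyp R K L s.+1 0.
  rewrite /hyp /= !bin0 mul1n addSn !subn0.
  have [e|ne] := eqVneq s (K + L)%N.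
    rewrite /q e divff ?pnatr_eq0 // subrr mul0r -e bin_small ?mul0r //.
    by rewrite e; lia.
  have sKL' : (s.+1 <= K + L)%N by rewrite ltn_neqAle ne.
  by rewrite mulrA [(1 - q) * _]mulrC -mulrA ratio_bin2.
rewrite -mulrA addrCA; congr (_ + _).
rewrite !mulr_sumr -big_split /=; apply: eq_bigr => i _.
by rewrite mulrDl !mulrA.
Qed.

Lemma hypE_unmarked K L s f : (s <= K + L)%N ->
  hypE K L.+1 s.+1 f =
    s.+1%:R / (K + L).+1%:R * hypE K L s f +
    (1 - s.+1%:R / (K + L).+1%:R) * hypE K L s.+1 f.
Proof.
move=> sKL; set q := _ / _.
have A i : hyp R K L.+1 s.+1 i = q * hyp R K L s i + (1 - q) * hyp R K L s.+1 i.
  rewrite /hyp addnS.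
  have [is_|is_] := leqP i s; last first.
    have [is2|is2] := leqP i s.+1; last by rewrite !mulr0 addr0.
    have -> : i = s.+1 by lia.
    rewrite subnn !bin0 muln1 mulr0 add0r.
    have [e|ne] := eqVneq s (K + L)%N.
      by rewrite /q e divff ?pnatr_eq0 // subrr mul0r bin_small ?mul0r //; lia.
    have sKL' : (s.+1 <= K + L)%N by rewrite ltn_neqAle ne.
    by rewrite mulrA [(1 - q) * _]mulrC -mulrA ratio_bin2.
  rewrite (leqW is_) subSn //; have [e|ne] := eqVneq s (K + L)%N.
    rewrite /q e divff ?pnatr_eq0 // subrr mul0r addr0 mul1r !binn -e.
    rewrite binS mulnDr (_ : 'C(K, i) * 'C(L, (s - i).+1) = 0)%N ?add0n //.
    have [h|h] := leqP i K; last by rewrite bin_small.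
    by rewrite (@bin_small L) ?muln0 // e; lia.
  have sKL' : (s.+1 <= K + L)%N by rewrite ltn_neqAle ne.
  rewrite [q * _]mulrCA [(1 - q) * _]mulrCA.
  rewrite ratio_bin1 // ratio_bin2 // -mulrDl -natrD; congr (_%:R / _).
  by rewrite binS mulnDr addnC.
have W : hypE K L s f = \sum_(i < s.+2) hyp R K L s i * f i.
  by rewrite big_ord_recr /= (@hyp_eq0 _ _ s s.+1) ?ltnn // mul0r addr0.
rewrite W !mulr_sumr -big_split /=; apply: eq_bigr => i _.
by rewrite A mulrDl !mulrA.
Qed.

(** Recolouring one item matters only if it is drawn: the undrawn parts of the two conditionings
    cancel. Recolouring the marked items one by one, with [K + L] fixed, gives the moments below. *)
Lemma hypE_swap K L s f : (s <= K + L)%N ->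
  hypE K.+1 L s.+1 f - hypE K L.+1 s.+1 f =
    s.+1%:R / (K + L).+1%:R * hypE K L s (fun i => f i.+1 - f i).
Proof. by move=> sKL; rewrite hypE_marked // hypE_unmarked // hypEB; ring. Qed.

Lemma hypE_0marked L s f : (s <= L)%N -> hypE 0 L s f = f 0%N.
Proof.
move=> sL; rewrite /hypE big_ord_recl big1 ?addr0 => [|i _].
  by rewrite /hyp /= bin0 mul1n subn0 add0n divff ?mul1r // pnatr_eq0 -lt0n bin_gt0.
by rewrite hyp_eq0 ?mul0r // andbF.
Qed.

Lemma hypE_0draws K L f : hypE K L 0 f = f 0%N.
Proof. by rewrite /hypE big_ord1 /hyp /= !bin0 muln1 divff ?mul1r ?oner_neq0. Qed.

Lemma hyp_mean K L s : (s <= K + L)%N ->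
  hypE K L s (fun i => i%:R) = s%:R * K%:R / (K + L)%:R :> R.
Proof.
elim: K L => [|K IH] L sKL.
  by rewrite hypE_0marked // mulr0 mul0r.
case: s => [|s] in IH sKL *; first by rewrite hypE_0draws !mul0r.
have e := @hypE_swap K L s (fun i => i%:R : R) ltac:(lia).
rewrite -[LHS](subrK (hypE K L.+1 s.+1 (fun i => i%:R))) e IH; last by lia.
rewrite (_ : hypE K L s _ = 1); last first.
  rewrite -[RHS](@hypE1 K L s) //; apply: eq_hypE => i _ _ _.
  by rewrite -natr1 addrAC subrr add0r.
by rewrite addnS addSn -[K.+1%:R]natr1 mulrDr mulrDl !mulr1 addrC.
Qed.

Lemma hyp_sqr K L s : (s <= K + L)%N ->
  hypE K L s (fun i => i%:R ^+ 2 : R) <=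
    (s%:R * K%:R / (K + L)%:R) ^+ 2 + s%:R * K%:R / (K + L)%:R.
Proof.
elim: K L => [|K IH] L sKL.
  by rewrite hypE_0marked // !(mulr0, mul0r) expr0n addr0.
case: s => [|s] in IH sKL *; first by rewrite hypE_0draws !mul0r expr0n addr0.
have e := @hypE_swap K L s (fun i => i%:R ^+ 2 : R) ltac:(lia).
rewrite -[leLHS](subrK (hypE K L.+1 s.+1 (fun i => i%:R ^+ 2))) e.
have := IH L.+1 ltac:(lia); set A := hypE K L.+1 _ _.
have -> : hypE K L s (fun i => i.+1%:R ^+ 2 - i%:R ^+ 2) =
    2 * (s%:R * K%:R / (K + L)%:R) + 1 :> R.
  rewrite -hyp_mean // -[X in _ = _ + X](@hypE1 K L s) // -hypEZ -hypED.
  by apply: eq_hypE => i _ _ _; rewrite -natr1; ring.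
rewrite addnS addSn -[K.+1%:R]natr1.
set N := (K + L)%N; set q : R := s.+1%:R / N.+1%:R => hA.
have q0 : 0 <= q by rewrite divr_ge0.
(* The mean does not decrease when one unmarked item and one draw are added, as [s <= N]. *)
have hq : s%:R * K%:R / N%:R <= q * K%:R.
  rewrite mulrAC ler_wpM2r //.
  have [->|N0] := posnP N; first by rewrite invr0 mulr0.
  rewrite ler_pdivrMr ?ltr0n // /q mulrAC ler_pdivlMr ?ltr0n //.
  rewrite -!natrM ler_nat; rewrite /N in sKL *; nia.
set z := s%:R * K%:R / N%:R in hq *.
have eq1 : s.+1%:R * K%:R / N.+1%:R = q * K%:R by rewrite /q; ring.
have eq2 : s.+1%:R * (K%:R + 1) / N.+1%:R = q * (K%:R + 1) by rewrite /q; ring.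
rewrite eq1 in hA; rewrite eq2.
apply: le_trans (lerD (lexx _) hA) _.
apply: le_trans (_ : q * (2 * (q * K%:R) + 1) + ((q * K%:R) ^+ 2 + q * K%:R) <= _).
  by rewrite lerD2r ler_wpM2l //; lra.
(* The two sides differ by exactly [q ^+ 2]. *)
have := sqr_ge0 q; lra.
Qed.

Lemma hyp_var K L s : (s <= K + L)%N ->
  hypE K L s (fun i => (i%:R - s%:R * K%:R / (K + L)%:R) ^+ 2 : R) <= s%:R.
Proof.
move=> sKL; set mu : R := _ / _.
have -> : hypE K L s (fun i => (i%:R - mu) ^+ 2) =
   hypE K L s (fun i => i%:R ^+ 2) - mu ^+ 2.
  transitivity (hypE K L s (fun i => i%:R ^+ 2) + (- 2 * mu) * hypE K L s (fun i => i%:R)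
     + hypE K L s (fun=> mu ^+ 2)).
    rewrite -hypEZ -!hypED; apply: eq_hypE => i _ _ _; ring.
  by rewrite hyp_mean // hypE_cst // -/mu; ring.
rewrite lerBlDl (le_trans (hyp_sqr sKL)) // lerD2l -mulrA ler_piMr //.
have [->|N0] := posnP (K + L)%N; first by rewrite invr0 mulr0.
by rewrite ler_pdivrMr ?ltr0n // mul1r ler_nat leq_addr.
Qed.

End Hypergeometric.

(* The variance of the law [hyp K.+1 L.+1 s.+1]. *)
Definition stein_coef (R : realType) (K L s : nat) : R :=
  s.+1%:R * K.+1%:R * (L.+1%:R * ((K + L).+1 - s)%:R) /
  ((K + L).+2%:R ^+ 2 * (K + L).+1%:R).

(** * Stein identity and smoothing for the hypergeometric law *)

Section Stein.
Variable R : realType.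
Implicit Types (K L s i j : nat) (f : nat -> R).

Let bin_diagR (n m : nat) :
  m.+1%:R * 'C(n.+1, m.+1)%:R = n.+1%:R * 'C(n, m)%:R :> R.
Proof.
by have /(congr1 (fun a => a%:R : R)) := mul_bin_diag n.+1 m; rewrite !natrM => ->.
Qed.

Let bin_downR (n m : nat) :
  (n.+1%:R - m%:R) * 'C(n.+1, m)%:R = n.+1%:R * 'C(n, m)%:R :> R.
Proof.
have [mn|mn] := leqP m n.+1; last by rewrite !bin_small ?mulr0 //; lia.
have /(congr1 (fun a => a%:R : R)) := mul_bin_down n.+1 m.
by rewrite !natrM natrB // => ->.
Qed.

(** The first factor equals [j (L - s + j) - (K + 1 - j) (s + 1 - j)]. Absorbing each of these
    products into the binomials gives one of the two weights on the right. *)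
Let stein_num K L s j : (j <= s.+1)%N ->
  ((K + L).+2%:R * j%:R - s.+1%:R * K.+1%:R) * ('C(K.+1, j) * 'C(L.+1, s.+1 - j))%:R =
  K.+1%:R * L.+1%:R *
    ((if j is j'.+1 then ('C(K, j') * 'C(L, s - j'))%:R else 0) -
     (if (j <= s)%N then ('C(K, j) * 'C(L, s - j))%:R else 0)) :> R.
Proof.
move=> js; set Y1 : R := if j is _.+1 then _ else _; set Y0 : R := if _ then _ else _.
have e1 : j%:R * (L%:R - s%:R + j%:R) * ('C(K.+1, j) * 'C(L.+1, s.+1 - j))%:R =
    K.+1%:R * L.+1%:R * Y1 :> R.
  rewrite {}/Y1; case: j js {Y0} => [|j] js; first by rewrite !mul0r mulr0.
  rewrite subSS !natrM.
  have -> : L%:R - s%:R + j.+1%:R = L.+1%:R - (s - j)%:R :> R.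
    by rewrite natrB // -!natr1; ring.
  transitivity (j.+1%:R * 'C(K.+1, j.+1)%:R *
    ((L.+1%:R - (s - j)%:R) * 'C(L.+1, s - j)%:R) : R); first by ring.
  by rewrite bin_diagR bin_downR; ring.
have e0 : (K.+1%:R - j%:R) * (s.+1%:R - j%:R) * ('C(K.+1, j) * 'C(L.+1, s.+1 - j))%:R =
    K.+1%:R * L.+1%:R * Y0 :> R.
  rewrite {}/Y0; case: leqP => js'; last first.
    by rewrite (_ : j = s.+1) ?subrr ?mulr0 ?mul0r //; lia.
  rewrite subSn // !natrM.
  have -> : s.+1%:R - j%:R = (s - j).+1%:R :> R.
    by rewrite -natr1 -[(s - j).+1%:R]natr1 natrB //; ring.
  transitivity ((K.+1%:R - j%:R) * 'C(K.+1, j)%:R *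
    ((s - j).+1%:R * 'C(L.+1, (s - j).+1)%:R) : R); first by ring.
  by rewrite bin_downR bin_diagR; ring.
rewrite mulrBr -e1 -e0 -mulrBl; congr (_ * _).
by rewrite -!natr1 natrD; ring.
Qed.

Let bin2R (N s : nat) : (s <= N)%N ->
  N.+2%:R * N.+1%:R * 'C(N, s)%:R = (N.+1 - s)%:R * s.+1%:R * 'C(N.+2, s.+1)%:R :> R.
Proof.
move=> sN; rewrite natrB 1?leqW //.
transitivity (N.+2%:R * ((N.+1%:R - s%:R) * 'C(N.+1, s)%:R) : R).
  by rewrite bin_downR; ring.
transitivity ((N.+1%:R - s%:R) * (N.+2%:R * 'C(N.+1, s)%:R) : R); first by ring.
by rewrite -bin_diagR; ring.
Qed.

Let stein_pmf K L s j : (s <= K + L)%N -> (j <= s.+1)%N ->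
  hyp R K.+1 L.+1 s.+1 j * (j%:R - s.+1%:R * K.+1%:R / (K + L).+2%:R) =
  stein_coef R K L s * ((if j is j'.+1 then hyp R K L s j' else 0) - hyp R K L s j).
Proof.
move=> sKL js; have := stein_num K L js.
set Y1 : R := if j is _.+1 then _ else _; set Y0 : R := if _ then _ else _.
have -> : (if j is j'.+1 then hyp R K L s j' else 0) = Y1 / 'C(K + L, s)%:R.
  by rewrite /Y1; case: j js {Y1 Y0} => [|j] js; rewrite ?mul0r // /hyp -ltnS js.
have -> : hyp R K L s j = Y0 / 'C(K + L, s)%:R.
  by rewrite /Y0 /hyp; case: ifP => //; rewrite mul0r.
rewrite /hyp js addSn addnS; set X : R := (_ * _)%:R => eX.
have := bin2R sKL; rewrite /stein_coef.
set c0 : R := 'C(K + L, s)%:R; set c1 : R := 'C((K + L).+2, s.+1)%:R.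
have c00 : c0 != 0 by rewrite pnatr_eq0 -lt0n bin_gt0.
have c10 : c1 != 0 by rewrite pnatr_eq0 -lt0n bin_gt0; lia.
have d0 : ((K + L).+1 - s)%:R != 0 :> R by rewrite pnatr_eq0 -lt0n subn_gt0 ltnS.
move: eX d0; set d : R := (_ - s)%:R.
have n10 : (K + L).+1%:R != 0 :> R by rewrite pnatr_eq0.
have n20 : (K + L).+2%:R != 0 :> R by rewrite pnatr_eq0.
have s0 : s.+1%:R != 0 :> R by rewrite pnatr_eq0.
move: n10 n20 s0; set n1 : R := (K + L).+1%:R; set n2 : R := (K + L).+2%:R.
set s1 : R := s.+1%:R; set K1 : R := K.+1%:R; set L1 : R := L.+1%:R.
set J : R := j%:R.
move=> n10 n20 s0 eX d0 e2; clearbody c0 c1 d n1 n2 s1 K1 L1 J X Y0 Y1.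
transitivity ((n2 * J - s1 * K1) * X / (c1 * n2)); first by field; rewrite n20 c10.
rewrite eX; transitivity (s1 * K1 * (L1 * d) * (Y1 - Y0) / (n2 * (n2 * n1 * c0))).
  by rewrite e2; field; rewrite c10 n20 d0 s0.
by field; rewrite c00 n20 n10.
Qed.

(** Summation by parts applied to [stein_pmf]. Taking the identity for [f] shows that the
    coefficient has to be the variance. *)
Lemma hypE_stein K L s f : (s <= K + L)%N ->
  hypE K.+1 L.+1 s.+1
    (fun j => (j%:R - s.+1%:R * K.+1%:R / (K + L).+2%:R) * f j) =
  stein_coef R K L s * hypE K L s (fun i => f i.+1 - f i).
Proof.
move=> sKL.
have -> : hypE K L s (fun i => f i.+1 - f i) =
    \sum_(j < s.+2) ((if j : nat is j'.+1 then hyp R K L s j' else 0) - hyp R K L s j) * f j.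
  rewrite hypEB.
  have -> : hypE K L s f = \sum_(j < s.+2) hyp R K L s j * f j.
    by rewrite big_ord_recr /= (@hyp_eq0 _ _ _ s s.+1) ?ltnn // mul0r addr0.
  rewrite (_ : hypE _ _ _ _ = \sum_(j < s.+2) (if j : nat is j'.+1 then hyp R K L s j' else 0) * f j).
    by rewrite -sumrB; apply: eq_bigr => j _; rewrite mulrBl.
  by rewrite big_ord_recl mul0r add0r; apply: eq_bigr.
rewrite mulr_sumr; apply: eq_bigr => j _.
by rewrite [LHS]mulrA [RHS]mulrA (stein_pmf sKL (ltn_ord j)).
Qed.

(** By Stein's identity the left side is at most [E |X - mu|], which the AM-GM inequality at scale
    [w] bounds by [(Var X / w + w) / 2 <= w]. With [w] of order sqrt n and a variance of order n,
    this is the O(1/sqrt n) smoothing. *)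
Lemma hypE_smooth K L s f (w : R) : (s <= K + L)%N -> (forall j, `|f j| <= 1) ->
  0 < w -> s.+1%:R <= w ^+ 2 ->
  stein_coef R K L s * `|hypE K L s (fun i => f i.+1 - f i)| <= w.
Proof.
move=> sKL f1 w0 sw.
have c0 : 0 <= stein_coef R K L s by rewrite /stein_coef divr_ge0 ?mulr_ge0.
rewrite -{1}(ger0_norm c0) -normrM -hypE_stein //; set mu : R := _ / _.
rewrite (le_trans (ler_norm_hypE _ _ _ _)) //.
apply: le_trans (_ : hypE K.+1 L.+1 s.+1 (fun j => (2 * w)^-1 * (j%:R - mu) ^+ 2 + w / 2) <= _).
  apply: le_hypE => j _ _ _; rewrite normrM (le_trans (ler_piMr _ (f1 j))) //.
  set a := j%:R - mu.
  have := sqr_ge0 (`|a| - w); rewrite -[a ^+ 2]real_normK ?num_real //.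
  move: (`|a|) => b h; rewrite -subr_ge0.
  rewrite (_ : _ - _ = (b - w) ^+ 2 / (2 * w)); last by field; rewrite gt_eqF.
  by rewrite divr_ge0 // mulr_ge0 // ltW.
rewrite hypED (hypEZ _ _ _ _ (fun j => (j%:R - mu) ^+ 2)) hypE_cst; last by lia.
have : hypE K.+1 L.+1 s.+1 (fun j => (j%:R - mu) ^+ 2) <= s.+1%:R.
  by have := @hyp_var R K.+1 L.+1 s.+1; rewrite addSn addnS => -> //; lia.
move=> hv.
apply: le_trans (_ : (2 * w)^-1 * w ^+ 2 + w / 2 <= _).
  by rewrite lerD2r ler_wpM2l ?invr_ge0 ?mulr_ge0 ?(ltW w0) // (le_trans hv).
by rewrite le_eqVlt; apply/orP; left; apply/eqP; field; rewrite gt_eqF.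
Qed.

End Stein.

(** * One step of the chain *)

(* x red and y white balls on the left, u red and v white balls on the right; s
   balls leave the left urn and t balls the right one.  The functions live on
   [int], where the increment of a red count is not truncated. *)
Definition urnE (R : realType) (x y u v s t : nat) (f : int -> R) (z : int) : R :=
  hypE x y s (fun i => hypE u v t (fun j => f (z + j%:Z - i%:Z))).

Section TwoUrns.
Variable R : realType.
Implicit Types (x y u v s t k : nat) (f g : int -> R) (z : int).

Lemma eq_urnE x y u v s t f g z : (forall z', f z' = g z') ->
  urnE x y u v s t f z = urnE x y u v s t g z.
Proof. by move=> fg; apply: eq_hypE => i _ _ _; apply: eq_hypE. Qed.

Lemma urnE_ge0 x y u v s t f z : (forall z', 0 <= f z') ->
  0 <= urnE x y u v s t f z.
Proof. by move=> f0; apply: hypE_ge0 => *; apply: hypE_ge0. Qed.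

Lemma ler_norm_urnE x y u v s t f g z : (forall z', `|f z'| <= g z') ->
  `|urnE x y u v s t f z| <= urnE x y u v s t g z.
Proof.
move=> fg; rewrite (le_trans (ler_norm_hypE _ _ _ _)) //; apply: le_hypE => *.
by rewrite (le_trans (ler_norm_hypE _ _ _ _)) //; apply: le_hypE => *.
Qed.

Lemma norm_urnE_le x y u v s t f z (B : R) : 0 <= B ->
  (forall z', `|f z'| <= B) -> `|urnE x y u v s t f z| <= B.
Proof. by move=> B0 fB; apply: norm_hypE_le => // *; apply: norm_hypE_le. Qed.

Lemma urnE_diff x y u v s t f z :
  urnE x y u v s t f (z + 1) - urnE x y u v s t f z =
  urnE x y u v s t (fun z' => f (z' + 1) - f z') z.
Proof.
rewrite -hypEB; apply: eq_hypE => i _ _ _; rewrite -hypEB.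
by apply: eq_hypE => j _ _ _; congr (f _ - _); ring.
Qed.

Lemma urnE_right_smooth x y u v s t f z (B : R) : 0 <= B ->
  (forall f' : nat -> R, (forall j, `|f' j| <= 1) ->
     `|hypE u v t (fun j => f' j.+1 - f' j)| <= B) ->
  (forall z', `|f z'| <= 1) ->
  `|urnE x y u v s t (fun z' => f (z' + 1) - f z') z| <= B.
Proof.
move=> B0 hB f1; apply: norm_hypE_le => // i _ _ _.
rewrite (_ : hypE u v t _ =
  hypE u v t (fun j => f (z + j.+1%:Z - i%:Z) - f (z + j%:Z - i%:Z))).
  by apply: (hB (fun j => f (z + j%:Z - i%:Z))).
by apply: eq_hypE => j _ _ _; rewrite -addn1 PoszD; congr (f _ - _); ring.
Qed.

Let pr x y k : R := k.+1%:R / (x + y).+1%:R.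

(** The distinguished balls are white on the left and red on the right. The four terms record which
    of them are drawn; the red one, when drawn, shifts the count by 1. *)
Lemma urnE_split0 x y u v k f z : (k <= x + y)%N -> (k <= u + v)%N ->
  urnE x y.+1 u.+1 v k.+1 k.+1 f z =
    pr x y k * pr u v k * urnE x y u v k k f (z + 1) +
    pr x y k * (1 - pr u v k) * urnE x y u v k k.+1 f z +
    (1 - pr x y k) * pr u v k * urnE x y u v k.+1 k f (z + 1) +
    (1 - pr x y k) * (1 - pr u v k) * urnE x y u v k.+1 k.+1 f z.
Proof.
move=> kxy kuv.
have inner s : hypE x y s (fun i => hypE u.+1 v k.+1 (fun j => f (z + j%:Z - i%:Z))) =
    pr u v k * urnE x y u v s k f (z + 1) + (1 - pr u v k) * urnE x y u v s k.+1 f z.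
  rewrite -!hypEZ -hypED; apply: eq_hypE => i _ _ _; rewrite hypE_marked //.
  congr (_ * _ + _); apply: eq_hypE => j _ _ _.
  by rewrite -addn1 PoszD; congr f; ring.
by rewrite {1}/urnE hypE_unmarked // !inner /pr; ring.
Qed.

(** The same urns with the two distinguished colours exchanged. The terms where exactly one of these
    balls is drawn are those of [urnE_split0], so they cancel in the difference. *)
Lemma urnE_split1 x y u v k f z : (k <= x + y)%N -> (k <= u + v)%N ->
  urnE x.+1 y u v.+1 k.+1 k.+1 f (z + 1) =
    pr x y k * pr u v k * urnE x y u v k k f z +
    pr x y k * (1 - pr u v k) * urnE x y u v k k.+1 f z +
    (1 - pr x y k) * pr u v k * urnE x y u v k.+1 k f (z + 1) +
    (1 - pr x y k) * (1 - pr u v k) * urnE x y u v k.+1 k.+1 f (z + 1).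
Proof.
move=> kxy kuv.
have inner s z' : hypE x y s (fun i => hypE u v.+1 k.+1 (fun j => f (z' + j%:Z - i%:Z))) =
    pr u v k * urnE x y u v s k f z' + (1 - pr u v k) * urnE x y u v s k.+1 f z'.
  by rewrite -!hypEZ -hypED; apply: eq_hypE => i _ _ _; rewrite hypE_unmarked.
rewrite {1}/urnE hypE_marked // inner.
have -> : hypE x y k (fun i => hypE u v.+1 k.+1 (fun j => f (z + 1 + j%:Z - i.+1%:Z))) =
   hypE x y k (fun i => hypE u v.+1 k.+1 (fun j => f (z + j%:Z - i%:Z))).
  apply: eq_hypE => i _ _ _; apply: eq_hypE => j _ _ _.
  by rewrite -[i.+1]addn1 PoszD; congr f; ring.
by rewrite inner /pr; ring.
Qed.

Lemma hyp_second_moment K L s (a : R) : (s <= K + L)%N ->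
  hypE K L s (fun i => (i%:R - s%:R * K%:R / (K + L)%:R + a) ^+ 2) <= s%:R + a ^+ 2.
Proof.
move=> sKL; have := @hyp_var R _ _ _ sKL; have := @hyp_mean R _ _ _ sKL.
set mu : R := _ / _ => hm hv.
rewrite (_ : hypE K L s _ = hypE K L s (fun i => (i%:R - mu) ^+ 2) +
    2 * a * (hypE K L s (fun i => i%:R) - hypE K L s (fun=> mu)) +
    hypE K L s (fun=> a ^+ 2)); last first.
  by rewrite -hypEB -hypEZ -!hypED; apply: eq_hypE => i _ _ _; ring.
by rewrite hm !hypE_cst // subrr mulr0 addr0 lerD2r.
Qed.

End TwoUrns.

(** The function [Pf], for [f] on all integers so that increments can be taken freely;
    [bl_kernel_next] ties it to the matrix. *)
Definition bl_next (R : realType) (n m r k : nat) (f : int -> R) (x : nat) : R :=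
  urnE x (m - x) (r - x) (n - m - (r - x)) k k f x%:Z.

Section OneStep.
Variable R : realType.
Variables n m r k : nat.
Hypotheses (mr_n : (m + r <= n)%N) (k0 : (0 < k)%N) (km : (k <= m)%N)
  (kn : (k < n - m)%N).
Implicit Types (f g : int -> R) (x : nat).

Let p : R := k%:R / m%:R.
Let q : R := k%:R / (n - m)%:R.
Let M := minn m r.
(** The urns deprived of their distinguished balls, hence the same for the states [x] and [x.+1]. *)
Let E x s t := @urnE R x (m - x.+1) (r - x.+1) (n - m - (r - x)) s t.

Let p01 : 0 <= p <= 1.
Proof.
rewrite /p divr_ge0 //= ler_pdivrMr ?mul1r ?ler_nat //.
by rewrite ltr0n (leq_trans k0).
Qed.

Let q01 : 0 <= q <= 1.
Proof.
rewrite /q divr_ge0 //= ler_pdivrMr ?mul1r ?ler_nat ?(ltnW kn) //.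
by rewrite ltr0n (leq_trans k0) // ltnW.
Qed.

Let bl_next_cur f x : (x < M)%N ->
  bl_next n m r k f x =
    p * q * E x k.-1 k.-1 f (x%:Z + 1) + p * (1 - q) * E x k.-1 k f x%:Z +
    (1 - p) * q * E x k k.-1 f (x%:Z + 1) + (1 - p) * (1 - q) * E x k k f x%:Z.
Proof.
move=> xM; have [xm xr] : (x < m)%N /\ (x < r)%N by rewrite /M in xM; lia.
have := @urnE_split0 R x (m - x.+1) (r - x.+1) (n - m - (r - x)) k.-1 f x%:Z.
have e1 : (x + (m - x.+1)).+1 = m by lia.
have e2 : (r - x.+1 + (n - m - (r - x))).+1 = (n - m)%N by lia.
have e3 : (m - x.+1).+1 = (m - x)%N by lia.
have e4 : (r - x.+1).+1 = (r - x)%N by lia.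
by rewrite (prednK k0) e1 e2 e3 e4; apply; lia.
Qed.

Let bl_next_succ f x : (x < M)%N ->
  bl_next n m r k f x.+1 =
    p * q * E x k.-1 k.-1 f x%:Z + p * (1 - q) * E x k.-1 k f x%:Z +
    (1 - p) * q * E x k k.-1 f (x%:Z + 1) + (1 - p) * (1 - q) * E x k k f (x%:Z + 1).
Proof.
move=> xM; have [xm xr] : (x < m)%N /\ (x < r)%N by rewrite /M in xM; lia.
have := @urnE_split1 R x (m - x.+1) (r - x.+1) (n - m - (r - x)) k.-1 f x%:Z.
have e1 : (x + (m - x.+1)).+1 = m by lia.
have e2 : (r - x.+1 + (n - m - (r - x))).+1 = (n - m)%N by lia.
have e3 : (n - m - (r - x)).+1 = (n - m - (r - x.+1))%N by lia.
have e4 : x.+1%:Z = x%:Z + 1 by rewrite -addn1 PoszD.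
by rewrite (prednK k0) e1 e2 e3 /bl_next e4; apply; lia.
Qed.

(** Two cases survive in the difference: neither distinguished ball is drawn and the discrepancy
    persists, or both are and it changes sign. *)
Let bl_next_step_le f x (B1 B2 : R) : (x < M)%N ->
  `|E x k k (fun z => f (z + 1) - f z) x%:Z| <= B1 ->
  `|E x k.-1 k.-1 (fun z => f (z + 1) - f z) x%:Z| <= B2 ->
  `|bl_next n m r k f x.+1 - bl_next n m r k f x| <=
    (1 - p) * (1 - q) * B1 + p * q * B2.
Proof.
move=> xM; rewrite /E -!urnE_diff -!/(E _ _ _).
rewrite (bl_next_cur f xM) (bl_next_succ f xM).
have /andP[p0 p1] := p01; have /andP[q0 q1] := q01.
move: p q p0 p1 q0 q1 => p' q' p0 p1 q0 q1 hD hA.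
have a0 : 0 <= p' * q' by rewrite mulr_ge0.
have b0 : 0 <= (1 - p') * (1 - q') by rewrite mulr_ge0 ?subr_ge0.
move: hA hD; set A1 := E x k.-1 k.-1 f _; set A2 := E x k.-1 k.-1 f _.
set D1 := E x k k f _; set D2 := E x k k f _ => hA hD.
rewrite [X in `|X|](_ : _ = (1 - p') * (1 - q') * (D1 - D2) - p' * q' * (A1 - A2)); last by ring.
rewrite (le_trans (ler_normB _ _)) // !(normrM (_ * _)) (ger0_norm a0) (ger0_norm b0).
by rewrite lerD // ler_wpM2l.
Qed.

Lemma bl_next_lipschitz f x (B : R) : 0 <= B -> (x < M)%N ->
  (forall z, `|f (z + 1) - f z| <= B) ->
  `|bl_next n m r k f x.+1 - bl_next n m r k f x| <=
    ((1 - p) * (1 - q) + p * q) * B.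
Proof.
move=> B0 xM fB; rewrite mulrDl; apply: bl_next_step_le => //.
  exact: norm_urnE_le.
exact: norm_urnE_le.
Qed.

(** Here the bound [g] depends on the position. This carries smoothness in the bulk over to every
    state, once [g] has a small mean after one step. *)
Lemma bl_next_variation f g x : (x < M)%N ->
  (forall z, `|f (z + 1) - f z| <= g z) ->
  `|bl_next n m r k f x.+1 - bl_next n m r k f x| <=
    bl_next n m r k g x + bl_next n m r k g x.+1.
Proof.
move=> xM fg.
have g0 z : 0 <= g z by rewrite (le_trans _ (fg z)).
have G s t z : 0 <= E x s t g z by exact: urnE_ge0.
rewrite (le_trans (bl_next_step_le xM (ler_norm_urnE _ _ _ _ _ _ _ fg)
  (ler_norm_urnE _ _ _ _ _ _ _ fg))) //.
rewrite (bl_next_cur g xM) (bl_next_succ g xM) -!/(E _ _ _).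
have /andP[p0 p1] := p01; have /andP[q0 q1] := q01.
have a0 : 0 <= p * q by rewrite mulr_ge0.
have b0 : 0 <= (1 - p) * (1 - q) by rewrite mulr_ge0 ?subr_ge0.
have c0 : 0 <= p * (1 - q) by rewrite mulr_ge0 ?subr_ge0.
have d0 : 0 <= (1 - p) * q by rewrite mulr_ge0 ?subr_ge0.
rewrite -subr_ge0; set lhs := (X in _ <= X).
(* Six nonnegative terms of the two expansions are left over. *)
rewrite (_ : lhs =
  p * q * E x k.-1 k.-1 g (x%:Z + 1) + p * (1 - q) * E x k.-1 k g x%:Z +
  (1 - p) * q * E x k k.-1 g (x%:Z + 1) +
  (p * (1 - q) * E x k.-1 k g x%:Z + (1 - p) * q * E x k k.-1 g (x%:Z + 1) +
  (1 - p) * (1 - q) * E x k k g (x%:Z + 1))); last by rewrite /lhs; ring.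
by rewrite !addr_ge0 // mulr_ge0.
Qed.

Let right_size x : (x < M)%N -> (k <= r - x.+1 + (n - m - (r - x)))%N.
Proof. by rewrite /M => xM; lia. Qed.

(** [sigma] bounds from below the Stein coefficients for both surviving cases, [k] and [k.-1] draws
    from the reduced right urn. The weights of the two cases add up to at most 1. *)
Lemma bl_next_smooth f x (w sigma : R) : (x < M)%N ->
  (forall z, `|f z| <= 1) -> 0 < w -> k.+1%:R <= w ^+ 2 -> 0 < sigma ->
  sigma <= stein_coef R (r - x.+1) (n - m - (r - x)) k ->
  sigma <= stein_coef R (r - x.+1) (n - m - (r - x)) k.-1 ->
  `|bl_next n m r k f x.+1 - bl_next n m r k f x| <= w / sigma.
Proof.
move=> xM f1 w0 kw s0 sk sk1.
have ws0 : 0 <= w / sigma by rewrite divr_ge0 // ltW.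
have H s : (s <= k)%N -> sigma <= stein_coef R (r - x.+1) (n - m - (r - x)) s ->
    `|E x s s (fun z => f (z + 1) - f z) x%:Z| <= w / sigma.
  move=> sk' hs; apply: urnE_right_smooth => // f' f'1.
  rewrite ler_pdivlMr // mulrC.
  apply: le_trans (ler_wpM2r _ hs) _ => //.
  apply: hypE_smooth => //; first exact: leq_trans sk' (right_size xM).
  by rewrite (le_trans _ kw) // ler_nat.
apply: le_trans (bl_next_step_le xM (H _ _ _) (H _ _ _)) _ => //; first exact: leq_pred.
have /andP[p0 p1] := p01; have /andP[q0 q1] := q01.
rewrite -mulrDl ler_piMl //; nra.
Qed.

(** Variance plus squared bias: each of the two draws has variance at most [k], and the next state
    has mean [(1 - p - q) x + q r]. *)
Lemma bl_next_sqr (e : R) x : (x <= M)%N ->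
  bl_next n m r k (fun z => (z%:~R - ((1 - p - q) * e + q * r%:R)) ^+ 2) x <=
    2 * k%:R + (1 - p - q) ^+ 2 * (x%:R - e) ^+ 2.
Proof.
move=> xM; have [xm xr] : (x <= m)%N /\ (x <= r)%N by rewrite /M in xM; lia.
have eL : (x + (m - x))%N = m by lia.
have eR : (r - x + (n - m - (r - x)))%N = (n - m)%N by lia.
have hs : (k <= r - x + (n - m - (r - x)))%N by rewrite eR ltnW.
set a := (1 - p - q) * (x%:R - e).
have inner i : hypE (r - x) (n - m - (r - x)) k (fun j =>
    ((x%:Z + j%:Z - i%:Z)%:~R - ((1 - p - q) * e + q * r%:R)) ^+ 2) <=
    k%:R + (i%:R - k%:R * x%:R / (x + (m - x))%:R + - a) ^+ 2.
  rewrite -[in leRHS]sqrrN.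
  apply: le_trans _ (hyp_second_moment _ hs).
  rewrite eL eR; apply: le_hypE => j _ _ _; rewrite le_eqVlt; apply/orP; left; apply/eqP.
  congr (_ ^+ 2); rewrite rmorphB rmorphD /= -!pmulrn /a /p /q (natrB _ xr).
  by ring.
apply: le_trans (_ : hypE x (m - x) k (fun i => k%:R +
  (i%:R - k%:R * x%:R / (x + (m - x))%:R + - a) ^+ 2) <= _).
  by apply: le_hypE => i _ _ _; exact: inner.
rewrite hypED hypE_cst; last by rewrite eL.
apply: le_trans (lerD (lexx _) (hyp_second_moment _ _)) _; first by rewrite eL.
by rewrite le_eqVlt; apply/orP; left; apply/eqP; rewrite /a; ring.
Qed.

Lemma bl_kernel_next f (x : 'I_(minn m r).+1) :
  (bl_kernel R n m r k *m \col_(y < (minn m r).+1) f (y : nat)%:Z) x 0 =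
    bl_next n m r k f x.
Proof.
have [xm xr] : (x <= m)%N /\ (x <= r)%N by have := ltn_ord x; lia.
rewrite mxE.
transitivity (\sum_(i < k.+1) \sum_(j < k.+1) \sum_(y < (minn m r).+1)
  (if (x + j == y + i)%N then hyp R x (m - x) k i * hyp R (r - x) (n - m - (r - x)) k j * f (y : nat)%:Z else 0)).
  transitivity (\sum_(y < (minn m r).+1) \sum_(i < k.+1) \sum_(j < k.+1)
  (if (x + j == y + i)%N then hyp R x (m - x) k i * hyp R (r - x) (n - m - (r - x)) k j * f (y : nat)%:Z else 0)).
    apply: eq_bigr => y _; rewrite !mxE mulr_suml; apply: eq_bigr => i _.
    rewrite big_mkcond mulr_suml; apply: eq_bigr => j _ /=.
    rewrite !hyp_pmf_hyp -1?ltnS //; last by lia.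
    by case: ifP; rewrite ?mul0r.
  by rewrite exchange_big; apply: eq_bigr => i _; rewrite exchange_big.
rewrite /bl_next /urnE /hypE; apply: eq_bigr => i _; rewrite mulr_sumr.
apply: eq_bigr => j _.
have [/and3P[i1 i2 i3]|/(hyp_eq0 R)->] := boolP [&& i <= k, i <= x & k - i <= m - x]%N; last first.
  by rewrite !mul0r big1 // => y _; rewrite !mul0r if_same.
have [/and3P[j1 j2 j3]|/(hyp_eq0 R)->] := boolP [&& j <= k, j <= r - x & k - j <= n - m - (r - x)]%N; last first.
  by rewrite !(mulr0, mul0r) big1 // => y _; rewrite mul0r if_same.
(* Draws that can occur lead to a genuine state, without truncation in the subtraction, so exactly
   one [y] contributes. *)
have yM : (x + j - i < (minn m r).+1)%N by lia.
rewrite -big_mkcond (big_pred1 (Ordinal yM)) /=; last first.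
  by move=> y; rewrite /= -val_eqE /=; apply/eqP/eqP; lia.
by rewrite mulrA; congr (_ * f _); lia.
Qed.

End OneStep.

(** * Stationarity and total variation *)

Section Stationary.
Variable R : realType.

Lemma binR (N s : nat) : (s <= N)%N ->
  'C(N, s)%:R = N`!%:R / (s`!%:R * (N - s)`!%:R) :> R.
Proof.
move=> sN; have /(congr1 (fun a => a%:R : R)) := bin_fact sN; rewrite !natrM => <-.
by rewrite mulfK // mulf_neq0 // pnatr_eq0 -lt0n fact_gt0.
Qed.

(** The marked set and the drawn set exchange roles: the size of their intersection has the same law
    whichever of the two is random. *)
Lemma hyp_sym (K L s i : nat) : (s <= K + L)%N ->
  hyp R K L s i = hyp R s (K + L - s) K i.
Proof.
move=> sKL; rewrite /hyp subnKC //.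
have [is_|is_] := leqP i s; last first.
  by case: leqP => // iK; rewrite (bin_small is_) mul0n mul0r.
have [iK|iK] := leqP i K; last by rewrite (bin_small iK) mul0n mul0r.
have [siL|siL] := leqP (s - i) L; last first.
  by rewrite (bin_small siL) (@bin_small (_ - _)) ?muln0 ?mul0r //; lia.
rewrite !natrM !binR; try lia.
have -> : (K + L - s - (K - i))%N = (L - (s - i))%N by lia.
have -> : (K + L - K)%N = L by lia.
have F a : a`!%:R != 0 :> R by rewrite pnatr_eq0 -lt0n fact_gt0.
move: (F K) (F L) (F s) (F i) (F (K - i)%N) (F (s - i)%N) (F (L - (s - i))%N)
  (F (K + L)%N) (F (K + L - s)%N).
set a1 : R := K`!%:R; set a2 : R := L`!%:R; set a3 : R := s`!%:R.
set a4 : R := i`!%:R; set a5 : R := (K - i)`!%:R; set a6 : R := (s - i)`!%:R.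
set a7 : R := (_ - _)`!%:R; set a8 : R := (_ + _)`!%:R; set a9 : R := (_ - _)`!%:R.
clearbody a1 a2 a3 a4 a5 a6 a7 a8 a9 => h1 h2 h3 h4 h5 h6 h7 h8 h9.
by field; rewrite h1 h2 h3 h4 h5 h6 h7 h8 h9.
Qed.

Variables n m r k : nat.
Hypothesis mr_n : (m + r <= n)%N.
Let P := bl_kernel R n m r k.
Let pi := bl_stationary R n m r.

Lemma bl_stationary_hyp x : pi 0 x = hyp R r (n - r) m x.
Proof.
have := ltn_ord x => xM.
have xm : (x <= m)%N by lia.
by rewrite mxE /hyp xm; have -> : (r + (n - r))%N = n by lia.
Qed.

Lemma bl_stationaryE (f : nat -> R) :
  \sum_x pi 0 x * f x = hypE r (n - r) m f.
Proof.
under eq_bigr do rewrite bl_stationary_hyp.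
rewrite /hypE (big_ord_widen_cond m.+1 xpredT (fun x => hyp R r (n - r) m x * f x)); last by lia.
rewrite big_mkcond; apply: eq_bigr => i _ /=; case: ltnP => // Mi.
rewrite hyp_eq0 ?mul0r //; apply/negP => /and3P[] _ ir _.
by have := ltn_ord i => im; lia.
Qed.

Hypotheses (km : (k <= m)%N) (kn : (k <= n - m)%N).

Let bl_kernelE x y : P x y = \sum_(i < k.+1) \sum_(j < k.+1 | (x + j == y + i)%N)
  hyp R x (m - x) k i * hyp R (r - x) (n - m - (r - x)) k j.
Proof.
rewrite mxE; apply: eq_bigr => i _; apply: eq_bigr => j _.
have := ltn_ord x => xM.
by rewrite !hyp_pmf_hyp -1?ltnS ?ltn_ord //; lia.
Qed.

Lemma bl_kernel_ge0 x y : 0 <= P x y.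
Proof.
rewrite bl_kernelE; apply: sumr_ge0 => i _; apply: sumr_ge0 => j _.
by rewrite mulr_ge0 ?hyp_ge0.
Qed.

(** Balance holds term by term: a swap sending [i] red balls out and bringing [j] in is undone by
    one sending [j] out and bringing [i] in. *)
Lemma bl_reversible x y : pi 0 x * P x y = pi 0 y * P y x.
Proof.
rewrite !bl_kernelE !mulr_sumr.
under eq_bigr do rewrite mulr_sumr big_mkcond.
under [RHS]eq_bigr do rewrite mulr_sumr big_mkcond.
rewrite [RHS]exchange_big; apply: eq_bigr => i _; apply: eq_bigr => j _ /=.
have -> : (y + i == x + j)%N = (x + j == y + i)%N by rewrite eq_sym.
case: eqP => // e; have xM := ltn_ord x; have yM := ltn_ord y.
(* By [hyp_sym] this is the probability that [r] red balls placed at random fall in prescribed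
   numbers into four groups: swapped and kept balls of either urn. Reversal exchanges the two
   swapped groups, which have equal size [k]. *)
have G (z : 'I_(minn m r).+1) a b : pi 0 z * (hyp R z (m - z) k a *
   hyp R (r - z) (n - m - (r - z)) k b) =
   if [&& a <= z, a <= k & z + b <= r]%N then
   ('C(k, a) * 'C(m - k, z - a) * 'C(k, b) * 'C(n - m - k, r - z - b))%:R / 'C(n, r)%:R else 0.
  have zM := ltn_ord z.
  rewrite bl_stationary_hyp hyp_sym; last by lia.
  rewrite (@hyp_sym z) ?(@hyp_sym (r - z)); try lia.
  have -> : (r + (n - r) - m = n - m)%N by lia.
  have -> : (z + (m - z) - k = m - k)%N by lia.
  have -> : (r - z + (n - m - (r - z)) - k = n - m - k)%N by lia.
  rewrite /hyp; have -> : (b <= r - z)%N = (z + b <= r)%N by lia.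
  have -> : (z <= r)%N by lia.
  case: leqP => az /=; last by rewrite !(mul0r, mulr0).
  case: leqP => zb; last by rewrite andbF !(mul0r, mulr0).
  have [ak|ak] := leqP a k; last by rewrite (bin_small ak) !(mul0n, mul0r, mulr0).
  have -> : (m + (n - m) = n)%N by lia.
  have -> : (k + (m - k) = m)%N by lia.
  have -> : (k + (n - m - k) = n - m)%N by lia.
  have h1 : 'C(m, z)%:R != 0 :> R by rewrite pnatr_eq0 -lt0n bin_gt0; lia.
  have h2 : 'C(n - m, r - z)%:R != 0 :> R by rewrite pnatr_eq0 -lt0n bin_gt0; lia.
  have h3 : 'C(n, r)%:R != 0 :> R by rewrite pnatr_eq0 -lt0n bin_gt0; lia.
  rewrite !natrM; move: h1 h2 h3.
  set c1 : R := 'C(m, z)%:R; set c2 : R := 'C(n - m, r - z)%:R; set c3 : R := 'C(n, r)%:R.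
  clearbody c1 c2 c3 => h1 h2 h3.
  by field; rewrite h1 h2 h3.
rewrite !G.
have -> : (i <= x)%N = (j <= y)%N by lia.
have -> : (x + j <= r)%N = (y + i <= r)%N by lia.
have -> : (i <= k)%N by rewrite -ltnS.
have -> : (j <= k)%N by rewrite -ltnS.
case: leqP => //= jy; case: leqP => //= yr.
have -> : (x - i = y - j)%N by lia.
have -> : (r - x - j = r - y - i)%N by lia.
by congr (_%:R / _); lia.
Qed.

End Stationary.

Section TotalVariation.
Variables (R : realType) (N : nat).
Implicit Types mu nu : 'rV[R]_N.

Lemma tv_dist_le mu nu (e : R) :
  (forall A : {set 'I_N}, `|\sum_(x in A) mu 0 x - \sum_(x in A) nu 0 x| <= e) ->
  tv_dist mu nu <= e.
Proof.
move=> h; apply: ge_sup; first by exists (`|\sum_(x in finset.set0) mu 0 x - \sum_(x in finset.set0) nu 0 x|), finset.set0.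
by move=> _ [A _ <-].
Qed.

Lemma tv_dist_ge mu nu (A : {set 'I_N}) :
  `|\sum_(x in A) mu 0 x - \sum_(x in A) nu 0 x| <= tv_dist mu nu.
Proof.
apply: ub_le_sup; last by exists A.
(* The l1 distance bounds the discrepancy on every event, so the supremum is proper. *)
exists (\sum_x `|mu 0 x - nu 0 x|) => _ [B _ <-].
rewrite -sumrB (le_trans (ler_norm_sum _ _ _)) // [leRHS](bigID (mem B)) /=.
by rewrite lerDl sumr_ge0.
Qed.

End TotalVariation.

(** * The chain acting on columns and distributions *)

(* Constant outside the state space, so that Lipschitz bounds are preserved. *)
Definition extend (R : realType) (M : nat) (g : 'cV[R]_M.+1) (z : int) : R :=
  if z is Posz a then g (inord (minn a M)) 0 else g ord0 0.

Definition lipschitz_col (R : realType) (M : nat) (g : 'cV[R]_M.+1) (B : R) :=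
  forall x : nat, (x < M)%N -> `|g (inord x.+1) 0 - g (inord x) 0| <= B.

Section Columns.
Variables (R : realType) (M : nat).
Implicit Types (g : 'cV[R]_M.+1) (B : R).

Lemma extend_ord g (y : 'I_M.+1) : extend g (y : nat)%:Z = g y 0.
Proof. by rewrite /extend (minn_idPl _) ?inord_val // -ltnS. Qed.

Lemma extend_variation g (L : int -> R) :
  (forall z, 0 <= L z) ->
  (forall a : nat, (a < M)%N -> `|g (inord a.+1) 0 - g (inord a) 0| <= L a%:Z) ->
  forall z, `|extend g (z + 1) - extend g z| <= L z.
Proof.
move=> L0 gL [a|a].
  have -> : Posz a + 1 = a.+1%:Z by rewrite -addn1 PoszD.
  rewrite /extend; case: (ltnP a M) => aM.
    by rewrite !(minn_idPl _) ?gL // ltnW.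
  by rewrite !(minn_idPr _) ?subrr ?normr0 // leqW.
case: a => [|a].
  rewrite (_ : Negz 0 + 1 = 0%:Z) // /extend min0n.
  by rewrite (_ : inord 0 = ord0) ?subrr ?normr0 //; apply/val_inj; rewrite /= inordK.
rewrite (_ : Negz a.+1 + 1 = Negz a); first by rewrite /extend subrr normr0.
by rewrite !NegzE; lia.
Qed.

Lemma lipschitz_col_dist g B (y z : 'I_M.+1) : lipschitz_col g B ->
  `|g y 0 - g z 0| <= B * `|(y : nat)%:R - (z : nat)%:R|.
Proof.
move=> gB.
have key (a b : nat) : (a + b < M.+1)%N ->
    `|g (inord (a + b)) 0 - g (inord a) 0| <= B * b%:R.
  elim: b => [|b IH] ab; first by rewrite addn0 subrr normr0 mulr0.
  rewrite addnS -(subrKA (g (inord (a + b)) 0)) (le_trans (ler_normD _ _)) //.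
  by rewrite -natr1 mulrDr mulr1 addrC lerD ?IH ?gB //; lia.
have key2 (u v : 'I_M.+1) : (u <= v)%N -> `|g v 0 - g u 0| <= B * (v%:R - u%:R).
  move=> uv; have := key u (v - u)%N; rewrite subnKC // !inord_val natrB //.
  by apply; exact: ltn_ord.
have [yz|/ltnW zy] := leqP y z.
  rewrite distrC [X in _ <= _ * X]distrC [X in _ <= _ * X]ger0_norm ?key2 //.
  by rewrite subr_ge0 ler_nat.
by rewrite [X in _ <= _ * X]ger0_norm ?key2 // subr_ge0 ler_nat.
Qed.

End Columns.

(** * Moments of distributions and comparison of expectations *)

Definition is_dist (R : realType) (N : nat) (mu : 'rV[R]_N) :=
  (forall x, 0 <= mu 0 x) /\ \sum_x mu 0 x = 1.

Definition sqdist (R : realType) (N : nat) (mu : 'rV[R]_N) (e : R) : R :=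
  \sum_x mu 0 x * ((x : nat)%:R - e) ^+ 2.

Section Distributions.
Variables (R : realType) (M : nat).
Implicit Types (mu nu : 'rV[R]_M.+1) (g : 'cV[R]_M.+1).

Lemma abs_dev_le mu (e w : R) : is_dist mu -> 0 < w ->
  \sum_x mu 0 x * `|(x : nat)%:R - e| <= (sqdist mu e / w + w) / 2.
Proof.
move=> [mu0 mu1] w0.
have -> : (sqdist mu e / w + w) / 2 =
    \sum_x mu 0 x * ((((x : nat)%:R - e) ^+ 2 / w + w) / 2).
  rewrite -[X in (_ + X) / 2]mulr1 -[X in w * X]mu1 /sqdist mulr_suml mulr_sumr -big_split /=.
  by rewrite mulr_suml; apply: eq_bigr => x _; ring.
apply: ler_sum => x _; apply: ler_wpM2l => //.
set a := _ - e; rewrite -[a ^+ 2]real_normK ?num_real //; move: `|a| => b.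
rewrite -subr_ge0 (_ : _ - _ = (b - w) ^+ 2 / (2 * w)); last by field; rewrite gt_eqF.
by rewrite divr_ge0 ?sqr_ge0 // mulr_ge0 // ltW.
Qed.

(** Couple the two laws independently and pass through [e] by the triangle inequality. *)
Lemma lipschitz_expect_diff mu nu g (B e : R) : is_dist mu -> is_dist nu ->
  lipschitz_col g B -> 0 <= B ->
  `|\sum_x mu 0 x * g x 0 - \sum_x nu 0 x * g x 0| <=
    B * (\sum_x mu 0 x * `|(x : nat)%:R - e| + \sum_x nu 0 x * `|(x : nat)%:R - e|).
Proof.
move=> [mu0 mu1] [nu0 nu1] gB B0.
have -> : \sum_x mu 0 x * g x 0 - \sum_x nu 0 x * g x 0 =
    \sum_x \sum_y mu 0 x * nu 0 y * (g x 0 - g y 0).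
  rewrite -[X in X - _]mulr1 -nu1 -[X in _ - X]mul1r -mu1 !mulr_suml -sumrB.
  apply: eq_bigr => x _; rewrite !mulr_sumr -sumrB; apply: eq_bigr => y _; ring.
have -> : \sum_x mu 0 x * `|(x : nat)%:R - e| + \sum_x nu 0 x * `|(x : nat)%:R - e| =
    \sum_x \sum_y mu 0 x * nu 0 y * (`|(x : nat)%:R - e| + `|(y : nat)%:R - e|).
  rewrite -[X in X + _]mulr1 -nu1 -[X in _ + X]mul1r -mu1 !mulr_suml -big_split.
  apply: eq_bigr => x _; rewrite !mulr_sumr -big_split; apply: eq_bigr => y _ /=; ring.
rewrite (le_trans (ler_norm_sum _ _ _)) // mulr_sumr; apply: ler_sum => x _.
rewrite (le_trans (ler_norm_sum _ _ _)) // mulr_sumr; apply: ler_sum => y _.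
have mn : 0 <= mu 0 x * nu 0 y by rewrite mulr_ge0.
rewrite normrM (ger0_norm mn) mulrCA; apply: ler_wpM2l => //.
rewrite (le_trans (lipschitz_col_dist _ _ gB)) //; apply: ler_wpM2l => //.
by rewrite -[X in `|X|](subrKA e) (le_trans (ler_normD _ _)) // lerD2l distrC.
Qed.

Lemma chebyshev_dist mu (e d : R) (A : {set 'I_M.+1}) : is_dist mu -> 0 < d ->
  (forall x, x \in A -> d <= `|(x : nat)%:R - e|) ->
  \sum_(x in A) mu 0 x <= sqdist mu e / d ^+ 2.
Proof.
move=> [mu0 _] d0 Ad; rewrite ler_pdivlMr ?exprn_gt0 // mulr_suml.
rewrite /sqdist [leRHS](bigID (mem A)) /=.
apply: le_trans (_ : \sum_(x in A) mu 0 x * ((x : nat)%:R - e) ^+ 2 <= _).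
  apply: ler_sum => x xA; apply: ler_wpM2l => //.
  by rewrite -[leRHS]real_normK ?num_real // lerXn2r ?nnegrE ?Ad // ltW.
by rewrite lerDl; apply: sumr_ge0 => x _; rewrite mulr_ge0 ?sqr_ge0.
Qed.

End Distributions.

(** * Invariance of the stationary law and second moments along the chain *)

Section Chain.
Variable R : realType.
Variables n m r k : nat.
Hypotheses (mr_n : (m + r <= n)%N) (k0 : (0 < k)%N) (km : (k <= m)%N)
  (kn : (k < n - m)%N).

Let p : R := k%:R / m%:R.
Let q : R := k%:R / (n - m)%:R.
Let M := minn m r.
Let P := bl_kernel R n m r k.
Let pi := bl_stationary R n m r.
Let lam : R := 1 - p - q.
Let center : R := m%:R * r%:R / n%:R.

Let n0 : (0 < n)%N. Proof. by lia. Qed.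
Let m0 : (0 < m)%N. Proof. by lia. Qed.

Lemma bl_kernel_col (g : 'cV[R]_M.+1) x : (P *m g) x 0 = bl_next n m r k (extend g) x.
Proof.
rewrite -bl_kernel_next //; congr ((_ *m _) x 0).
by apply/colP => y; rewrite mxE extend_ord.
Qed.

Lemma bl_next_affine (a b : R) (f : int -> R) x : (x <= M)%N ->
  bl_next n m r k (fun z => b + a * f z) x = b + a * bl_next n m r k f x.
Proof.
rewrite /M => xM; rewrite /bl_next /urnE.
rewrite -[in RHS](@hypE_cst _ x (m - x) k b); last by lia.
rewrite -hypEZ -hypED; apply: eq_hypE => i _ _ _.
by rewrite -hypEZ -[b in RHS](@hypE_cst _ (r - x) (n - m - (r - x)) k b) ?hypED //; lia.
Qed.

Lemma bl_next1 x : (x <= M)%N -> bl_next n m r k (fun=> 1 : R) x = 1.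
Proof.
move=> xM; rewrite -[RHS]addr0 -[X in _ = _ + X](mul0r (bl_next n m r k (fun=> 1) x)) -bl_next_affine //.
by apply: eq_urnE => z; rewrite mul0r addr0.
Qed.

Lemma bl_kernel_sum1 x : \sum_y P x y = 1.
Proof.
rewrite -(@bl_next1 x); last by rewrite -ltnS.
rewrite -bl_kernel_next // mxE; apply: eq_bigr => y _.
by rewrite !mxE mulr1.
Qed.

Lemma bl_stationary_dist : is_dist pi.
Proof.
split=> [x|]; first by rewrite bl_stationary_hyp // hyp_ge0.
rewrite -(@hypE1 R r (n - r) m); last by lia.
by rewrite -bl_stationaryE //; apply: eq_bigr => x _; rewrite mulr1.
Qed.

Lemma bl_stationaryP : pi *m P = pi.
Proof.
apply/rowP => y; rewrite mxE.
under eq_bigr do rewrite (bl_reversible _ mr_n km (ltnW kn)).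
by rewrite -mulr_sumr bl_kernel_sum1 mulr1.
Qed.

Lemma bl_stationary_iter t : pi *m P ^+ t = pi.
Proof.
elim: t => [|t IH]; first by rewrite expr0 mulmx1.
by rewrite exprS mulmxA bl_stationaryP.
Qed.

Lemma bl_stationary_sqdist : sqdist pi center <= n%:R.
Proof.
rewrite /sqdist (bl_stationaryE mr_n (fun x => (x%:R - center) ^+ 2)).
have e : (r + (n - r) = n)%N by lia.
have := @hyp_var R r (n - r) m; rewrite e => /(_ ltac:(lia)) h.
by rewrite (le_trans h) // ler_nat; lia.
Qed.

Lemma is_dist_step mu : is_dist mu -> is_dist (mu *m P).
Proof.
move=> [mu0 mu1]; split=> [y|].
  by rewrite mxE sumr_ge0 // => x _; rewrite mulr_ge0 // bl_kernel_ge0 // ltnW.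
under eq_bigr do rewrite mxE.
rewrite exchange_big -{}mu1; apply: eq_bigr => x _.
by rewrite -mulr_sumr bl_kernel_sum1 mulr1.
Qed.

Lemma is_dist_iter mu t : is_dist mu -> is_dist (mu *m P ^+ t).
Proof.
move=> h; elim: t => [|t IH]; first by rewrite expr0 mulmx1.
by rewrite exprSr mulmxA; exact: is_dist_step.
Qed.

Lemma is_dist_delta (x : 'I_M.+1) : is_dist (delta_mx 0 x : 'rV[R]_M.+1).
Proof.
split=> [y|]; first by rewrite mxE ler0n.
rewrite (bigD1 x) //= mxE !eqxx big1 ?addr0 // => y /negPf yx.
by rewrite mxE yx andbF.
Qed.

Lemma sqdist_delta (x : 'I_M.+1) (e : R) :
  sqdist (delta_mx 0 x : 'rV[R]_M.+1) e = ((x : nat)%:R - e) ^+ 2.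
Proof.
rewrite /sqdist (bigD1 x) //= mxE !eqxx mul1r big1 ?addr0 // => y /negPf yx.
by rewrite mxE yx andbF mul0r.
Qed.

Lemma sqdist_step mu (e : R) : is_dist mu -> (2 * m <= n)%N ->
  sqdist (mu *m P) (lam * e + q * r%:R) <= n%:R + lam ^+ 2 * sqdist mu e.
Proof.
move=> [mu0 mu1] mn.
have -> : sqdist (mu *m P) (lam * e + q * r%:R) = \sum_x mu 0 x *
    bl_next n m r k (fun z => (z%:~R - (lam * e + q * r%:R)) ^+ 2) x.
  rewrite /sqdist.
  under eq_bigr do rewrite mxE mulr_suml.
  rewrite exchange_big; apply: eq_bigr => x _ /=.
  rewrite -bl_kernel_next // mxE mulr_sumr; apply: eq_bigr => y _.
  by rewrite mulrA; congr (_ * _); rewrite mxE -pmulrn.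
rewrite -[X in _ <= X + _]mulr1 -[X in _ <= _ * X + _]mu1 /sqdist !mulr_sumr -big_split; apply: ler_sum => x _ /=.
rewrite [_ * mu 0 x]mulrC [lam ^+ 2 * _]mulrCA -mulrDr; apply: ler_wpM2l => //.
apply: le_trans (bl_next_sqr mr_n k0 km kn e _) _; first by rewrite -ltnS.
by rewrite -/p -/q -/lam lerD2r -natrM ler_nat; lia.
Qed.

Lemma center_fixed : lam * center + q * r%:R = center.
Proof.
have nm0 : (n - m)%:R != 0 :> R by rewrite pnatr_eq0 -lt0n; lia.
move: nm0; rewrite /lam /center /p /q natrB; last by lia.
have : m%:R != 0 :> R by rewrite pnatr_eq0 -lt0n.
have : n%:R != 0 :> R by rewrite pnatr_eq0 -lt0n.
by move=> h1 h2 h3; field; rewrite h1 h2 h3.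
Qed.

(** The reference point follows the affine recursion of the mean, whose fixed point is [center],
    while [V] absorbs the variance added at each step. The upper bound takes [e = center], the lower
    bound the starting state [e = 0]. *)
Lemma sqdist_iter mu t (e V : R) : is_dist mu -> (2 * m <= n)%N ->
  0 <= V -> n%:R + lam ^+ 2 * V <= V ->
  sqdist (mu *m P ^+ t) (center + lam ^+ t * (e - center)) <=
    V + lam ^+ (2 * t) * sqdist mu e.
Proof.
move=> mud mn V0 nV; elim: t => [|t IH].
  by rewrite expr0 mulmx1 mul1r addrC subrK mul1r lerDr.
rewrite exprSr mulmxA.
have -> : center + lam ^+ t.+1 * (e - center) =
    lam * (center + lam ^+ t * (e - center)) + q * r%:R.
  by rewrite -{1}center_fixed exprS; ring.
apply: le_trans (sqdist_step _ _ mn) _; first exact: is_dist_iter.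
apply: le_trans (lerD (lexx _) (ler_wpM2l (sqr_ge0 _) IH)) _.
by rewrite mulrDr addrA mulrA -exprD (_ : 2 + 2 * t = 2 * t.+1)%N ?lerD2r //; lia.
Qed.

End Chain.

(** * Bounds uniform in n *)

Ltac nat_lia := repeat match goal with
  | H : is_true (@Order.le _ _ _ _) |- _ => clear H
  | H : is_true (@Order.lt _ _ _ _) |- _ => clear H
  | H : is_true (_ && _) |- _ => clear H
  | H : @eq ?T _ _ |- _ => lazymatch T with nat => fail | _ => clear H end
  end; lia.

Section Quantitative.
Variable R : realType.
Variables n m r k : nat.
(** A single margin keeps [k/n], [r/n] and [(n - m - k)/n] away from 0. *)
Variable delta : R.
Hypotheses (rn : (2 * r <= n)%N) (mn : (2 * m <= n)%N) (k0 : (0 < k)%N)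
  (km : (k <= m)%N).
Hypotheses (delta0 : 0 < delta) (delta_k : delta * n%:R <= k%:R)
  (delta_r : delta * n%:R <= r%:R) (delta_n : k%:R + delta * n%:R <= (n - m)%:R).

Let p : R := k%:R / m%:R.
Let q : R := k%:R / (n - m)%:R.
Let M := minn m r.
Let P := bl_kernel R n m r k.
Let pi := bl_stationary R n m r.
Let lam : R := 1 - p - q.
Let center : R := m%:R * r%:R / n%:R.

Let n0 : (0 < n)%N. Proof. by nat_lia. Qed.
Let m0 : (0 < m)%N. Proof. by nat_lia. Qed.
Let mr_n : (m + r <= n)%N. Proof. by nat_lia. Qed.
Let nR0 : 0 < n%:R :> R. Proof. by rewrite ltr0n. Qed.
Let kn : (k < n - m)%N.
Proof. by rewrite -(ltr_nat R) (lt_le_trans _ delta_n) // ltrDl mulr_gt0. Qed.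

Let mR0 : 0 < m%:R :> R. Proof. by rewrite ltr0n. Qed.
Let nmR0 : 0 < (n - m)%:R :> R. Proof. by rewrite ltr0n; nat_lia. Qed.

Let pm : p * m%:R = k%:R.
Proof. by rewrite /p divfK // gt_eqF. Qed.

Let qnm : q * (n - m)%:R = k%:R.
Proof. by rewrite /q divfK // gt_eqF. Qed.

Let p_bounds : delta <= p <= 1.
Proof.
rewrite /p ler_pdivlMr // ler_pdivrMr // mul1r ler_nat km andbT.
rewrite (le_trans _ delta_k) // ler_wpM2l ?(ltW delta0) // ler_nat; nat_lia.
Qed.

Let q_bounds : delta <= q <= 1 - delta.
Proof.
have nmn : (n - m)%:R <= n%:R :> R by rewrite ler_nat; nat_lia.
apply/andP; split.
  by rewrite /q ler_pdivlMr // (le_trans _ delta_k) // ler_wpM2l ?(ltW delta0).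
rewrite /q ler_pdivrMr // mulrBl mul1r lerBrDr (le_trans _ delta_n) // lerD2l.
by rewrite ler_wpM2l ?(ltW delta0).
Qed.

(** An average of [1 - q] and [q], both at most [1 - delta], with weights [1 - p] and [p]. *)
Let rho_le : (1 - p) * (1 - q) + p * q <= 1 - delta.
Proof.
have /andP[p1 p2] := p_bounds; have /andP[q1 q2] := q_bounds.
have -> : 1 - delta = (1 - p) * (1 - delta) + p * (1 - delta) by ring.
have := delta0; move: p q p1 p2 q1 q2 => p' q' p1 p2 q1 q2 d0.
rewrite lerD // ler_wpM2l //; lra.
Qed.

(** Since [lam = (1 - p)(1 - q) - p q], its modulus is at most the Lipschitz factor of [rho_le]. *)
Lemma bl_eigenvalue_le : `|lam| <= 1 - delta.
Proof.
have /andP[p1 p2] := p_bounds; have /andP[q1 q2] := q_bounds.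
have := rho_le; have := delta0; rewrite /lam; move: p q p1 p2 q1 q2 => p' q' p1 p2 q1 q2 d0 rl.
rewrite ler_norml; apply/andP; split; nra.
Qed.

Let delta_le1 : 0 <= 1 - delta.
Proof. by rewrite (le_trans _ bl_eigenvalue_le). Qed.

Let lam_sqr : lam ^+ 2 <= 1 - delta.
Proof.
rewrite -real_normK ?num_real // (@le_trans _ _ ((1 - delta) ^+ 2)) //.
  by rewrite lerXn2r ?nnegrE ?bl_eigenvalue_le.
by have := delta_le1; have := delta0; nra.
Qed.

Lemma lipschitz_step (g : 'cV[R]_M.+1) (B : R) : 0 <= B -> lipschitz_col g B ->
  lipschitz_col (P *m g) ((1 - delta) * B).
Proof.
move=> B0 gB x xM; rewrite !bl_kernel_col ?inordK ?ltnS ?(ltnW xM) //.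
have := @bl_next_lipschitz R n m r k mr_n k0 km kn (extend g) x B B0 xM.
move=> /(_ (extend_variation (fun=> B0) gB)) /le_trans; apply.
exact: ler_wpM2r.
Qed.

Lemma lipschitz_iter (g : 'cV[R]_M.+1) (B : R) s : 0 <= B -> lipschitz_col g B ->
  lipschitz_col (P ^+ s *m g) ((1 - delta) ^+ s * B).
Proof.
move=> B0 gB; elim: s => [|s IH]; first by rewrite !expr0 mul1mx mul1r.
rewrite !exprS -mulrA -mulmxA; apply: lipschitz_step => //.
by rewrite mulr_ge0 // exprn_ge0.
Qed.

Lemma bl_next_norm_le1 (f : int -> R) x : (forall z, `|f z| <= 1) ->
  `|bl_next n m r k f x| <= 1.
Proof. by move=> f1; apply: norm_urnE_le. Qed.

Lemma extend_norm_le1 (f : 'cV[R]_M.+1) : (forall y, `|f y 0| <= 1) ->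
  forall z, `|extend f z| <= 1.
Proof. by move=> f1 [a|a]; exact: f1. Qed.

(** Both the drawn and the undrawn balls number at least [delta n]. With [b] of order n the variance
    is thus of order n. *)
Lemma stein_coef_bulk K L s (b : R) : (K + L).+1 = (n - m)%N ->
  (s <= k)%N -> (k <= s.+1)%N -> 0 <= b -> b <= K.+1%:R -> b <= L.+1%:R ->
  (delta * b) ^+ 2 / n%:R <= stein_coef R K L s.
Proof.
move=> KL sk ks b0 bK bL; rewrite /stein_coef.
have nn : (K + L).+2%:R <= n%:R :> R by rewrite ler_nat; nat_lia.
have nn1 : (K + L).+1%:R <= n%:R :> R by rewrite ler_nat; nat_lia.
have dn0 : 0 <= delta * n%:R by rewrite mulr_ge0 // ltW.
have hs : delta * n%:R <= s.+1%:R by rewrite (le_trans delta_k) // ler_nat.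
have hN : delta * n%:R <= ((K + L).+1 - s)%:R.
  rewrite KL natrB; last by nat_lia.
  rewrite lerBrDr (le_trans _ delta_n) // addrC lerD2r ler_nat //.
have num : delta * n%:R * b * (b * (delta * n%:R)) <=
    s.+1%:R * K.+1%:R * (L.+1%:R * ((K + L).+1 - s)%:R).
  by apply: ler_pM; [exact: mulr_ge0|exact: mulr_ge0|exact: ler_pM|exact: ler_pM].
have den : (K + L).+2%:R ^+ 2 * (K + L).+1%:R <= n%:R ^+ 2 * n%:R :> R.
  by rewrite ler_pM ?exprn_ge0 // lerXn2r ?nnegrE.
have -> : (delta * b) ^+ 2 / n%:R =
    delta * n%:R * b * (b * (delta * n%:R)) / (n%:R ^+ 2 * n%:R).
  by field; rewrite gt_eqF.
apply: ler_pM => //.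
- exact: mulr_ge0 (mulr_ge0 dn0 b0) (mulr_ge0 b0 dn0).
- by rewrite lef_pV2 // posrE mulr_gt0 // exprn_gt0 // ltr0n.
Qed.

(* The mean of the chain one step after x. *)
Let drift (x : nat) : R := lam * x%:R + q * r%:R.

(** The expected number of red balls on the right after one step: those that stay plus those that
    arrive, each ball with probability at least [delta]. With [drift_white], one step leads on
    average into the bulk from every state. *)
Let drift_red (x : nat) : (x <= M)%N -> delta ^+ 2 * n%:R <= r%:R - drift x.
Proof.
rewrite /M => xM; have /andP[p1 p2] := p_bounds; have /andP[q1 q2] := q_bounds.
have -> : r%:R - drift x = (r - x)%:R * (1 - q) + x%:R * p.
  by rewrite /drift /lam natrB; [ring|nat_lia].
apply: le_trans (_ : (r - x)%:R * delta + x%:R * delta <= _).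
  rewrite -mulrDl -natrD subnK; last by nat_lia.
  by rewrite expr2 -mulrA mulrC ler_wpM2r // ltW.
by apply: lerD; apply: ler_wpM2l => //; lra.
Qed.

Let drift_white (x : nat) : (x <= M)%N ->
  delta ^+ 2 * n%:R <= (n - m)%:R - (r%:R - drift x).
Proof.
rewrite /M => xM; have /andP[p1 p2] := p_bounds; have /andP[q1 q2] := q_bounds.
have -> : (n - m)%:R - (r%:R - drift x) =
    (n - m - (r - x))%:R * (1 - q) + (m - x)%:R * p.
  have : p * m%:R = q * (n - m)%:R by rewrite pm qnm.
  rewrite /drift /lam (@natrB _ (n - m) (r - x)); last by nat_lia.
  rewrite (@natrB _ r x); last by nat_lia.
  rewrite (@natrB _ m x); last by nat_lia.
  move: p q (n - m)%:R => p' q' a e.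
  transitivity (a - r%:R + x%:R - p' * x%:R - q' * x%:R + q' * r%:R
    + (p' * m%:R - q' * a)); last by ring.
  by rewrite e; ring.
apply: le_trans (_ : (n - m - (r - x))%:R * delta + (m - x)%:R * delta <= _).
  rewrite -mulrDl -natrD expr2 -mulrA mulrC ler_wpM2r ?(ltW delta0) //.
  by rewrite (le_trans delta_r) // ler_nat; nat_lia.
by apply: lerD; apply: ler_wpM2l => //; lra.
Qed.

Let w : R := Num.sqrt n%:R.
Let w0 : 0 < w. Proof. by rewrite sqrtr_gt0. Qed.
Let w2 : w ^+ 2 = n%:R. Proof. by rewrite sqr_sqrtr. Qed.
Let w1 : 1 <= w.
Proof. by rewrite -sqrtr1 ler_wsqrtr // ler1n. Qed.

(** Stein smoothing applies near [drift x], and the trivial bound 2 far from it. The quadratic term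
    equals 2 at the threshold distance [delta^2 n / 2], so one formula, easily averaged over a step,
    covers both. *)
Let increment_bound (f : int -> R) (x a : nat) : (forall z, `|f z| <= 1) ->
  (x <= M)%N -> (a < M)%N ->
  `|bl_next n m r k f a.+1 - bl_next n m r k f a| <=
    4 / (delta ^+ 6 * w) + 8 / (delta ^+ 2 * n%:R) ^+ 2 * (a%:R - drift x) ^+ 2.
Proof.
move=> f1 xM aM; have dn0 : 0 < delta ^+ 2 * n%:R by rewrite mulr_gt0 ?exprn_gt0.
have B0 : 0 <= 4 / (delta ^+ 6 * w) by rewrite divr_ge0 // mulr_ge0 ?exprn_ge0 // ltW.
have [near_|far] := leP `|a%:R - drift x| (delta ^+ 2 * n%:R / 2); last first.
  apply: le_trans (_ : 2 <= _).
    by rewrite (le_trans (ler_normB _ _)) // (_ : 2 = 1 + 1) // lerD ?bl_next_norm_le1.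
  rewrite -[leLHS]add0r; apply: lerD => //.
  rewrite mulrAC ler_pdivlMr ?exprn_gt0 // -[(a%:R - _) ^+ 2]real_normK ?num_real //.
  have := far; move: `|_| => b; move: dn0; move: (delta ^+ 2 * n%:R) => c c0 cb; nra.
rewrite -[leLHS]addr0; apply: lerD; last first.
  by rewrite mulr_ge0 ?sqr_ge0 // divr_ge0 // sqr_ge0.
(* Below the threshold, half of the balls granted by [drift_red] and [drift_white] remain in the
   right urn. *)
set b := delta ^+ 2 * n%:R / 2.
have b0 : 0 <= b by rewrite /b divr_ge0 // ltW.
move: near_; rewrite ler_norml => /andP[na1 na2].
have hr := drift_red xM; have hw := drift_white xM.
have xar : (a < r)%N by rewrite /M in aM; nat_lia.
have bK : b <= (r - a.+1).+1%:R.
  by rewrite subnSK // natrB 1?ltnW //; move: na1 na2 hr; rewrite /b; lra.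
have bL : b <= (n - m - (r - a)).+1%:R.
  rewrite -natr1 natrB; last by nat_lia.
  by rewrite (@natrB _ r a) 1?ltnW //; move: na1 na2 hw; rewrite /b; lra.
have KL : (r - a.+1 + (n - m - (r - a))).+1 = (n - m)%N by nat_lia.
have sg : (delta * b) ^+ 2 / n%:R = delta ^+ 6 * n%:R / 4.
  by rewrite /b; field; rewrite gt_eqF.
have := @bl_next_smooth R n m r k mr_n k0 km kn f a w (delta ^+ 6 * n%:R / 4) aM f1 w0.
rewrite (_ : w / (delta ^+ 6 * n%:R / 4) = 4 / (delta ^+ 6 * w)); last first.
  by rewrite -w2; field; rewrite !gt_eqF.
apply.
- by rewrite w2 ler_nat; nat_lia.
- by rewrite divr_gt0 // mulr_gt0 // exprn_gt0.
- by rewrite -sg; apply: stein_coef_bulk => //; nat_lia.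
- by rewrite -sg; apply: stein_coef_bulk => //; nat_lia.
Qed.

(** [bl_next_variation] averages [increment_bound] over one step. The squared deviation has mean
    O(n) and coefficient O(1/n^2), so the states outside the bulk add only O(1/n). *)
Lemma lipschitz_two_steps (f : 'cV[R]_M.+1) : (forall y, `|f y 0| <= 1) ->
  lipschitz_col (P *m (P *m f)) ((8 / delta ^+ 6 + 24 / delta ^+ 4) / w).
Proof.
move=> f1 x xM; rewrite !bl_kernel_col ?inordK ?ltnS ?(ltnW xM) //.
set A := 8 / (delta ^+ 2 * n%:R) ^+ 2; set B := 4 / (delta ^+ 6 * w).
have A0 : 0 <= A by rewrite divr_ge0 // sqr_ge0.
have B0 : 0 <= B by rewrite divr_ge0 // mulr_ge0 ?exprn_ge0 // ltW.
have V := @bl_next_variation R n m r k mr_n k0 km kn (extend (P *m f))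
  (fun z => B + A * (z%:~R - drift x) ^+ 2) x xM.
apply: le_trans (V _) _.
  apply: extend_variation => [z|a aM]; first by rewrite addr_ge0 // mulr_ge0 // sqr_ge0.
  rewrite !bl_kernel_col ?inordK ?ltnS ?(ltnW aM) // -pmulrn.
  by apply: increment_bound => //; [exact: extend_norm_le1|exact: ltnW].
rewrite !bl_next_affine //; last exact: ltnW.
have S1 := @bl_next_sqr R n m r k mr_n k0 km kn x%:R x (ltnW xM).
have S2 := @bl_next_sqr R n m r k mr_n k0 km kn x%:R x.+1 xM.
rewrite -/p -/q -/lam -/(drift x) in S1 S2.
have kn2 : 2 * k%:R <= n%:R :> R by rewrite -natrM ler_nat; nat_lia.
have n1 : 1 <= n%:R :> R by rewrite ler1n.
have lam1 : lam ^+ 2 <= 1 by rewrite (le_trans lam_sqr) // gerBl ltW.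
have S1' : bl_next n m r k (fun z => (z%:~R - drift x) ^+ 2) x <= n%:R.
  by rewrite (le_trans S1) // subrr expr0n mulr0 addr0.
(* From [x.+1] the squared bias is [lam^2 <= 1], and [2 k + 1 <= 2 n]. *)
have S2' : bl_next n m r k (fun z => (z%:~R - drift x) ^+ 2) x.+1 <= 2 * n%:R.
  have e : x.+1%:R - x%:R = 1 :> R by rewrite -natr1 addrAC subrr add0r.
  by apply: le_trans S2 _; rewrite e expr1n mulr1; lra.
apply: le_trans (_ : B + A * n%:R + (B + A * (2 * n%:R)) <= _).
  by rewrite !lerD // ler_wpM2l.
have -> : B + A * n%:R + (B + A * (2 * n%:R)) =
    8 / (delta ^+ 6 * w) + 24 / (delta ^+ 4 * n%:R).
  by rewrite /A /B; field; rewrite !gt_eqF.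
rewrite (_ : (8 / delta ^+ 6 + 24 / delta ^+ 4) / w =
    8 / (delta ^+ 6 * w) + 24 / (delta ^+ 4 * w)); last by field; rewrite !gt_eqF.
rewrite lerD2l ler_wpM2l // lef_pV2 ?posrE ?mulr_gt0 ?exprn_gt0 //.
by rewrite ler_wpM2l ?exprn_ge0 ?(ltW delta0) // -w2 expr2 ler_peMr // ltW.
Qed.

(** This makes [n / delta] an admissible [V] in [sqdist_iter]. *)
Let var_fix : n%:R + lam ^+ 2 * (n%:R / delta) <= n%:R / delta.
Proof.
set v := n%:R / delta; have v0 : 0 <= v by rewrite /v divr_ge0 // ltW.
have e : n%:R = delta * v by rewrite /v mulrC divfK // gt_eqF.
by rewrite e -mulrDl ler_piMl //; have := lam_sqr; lra.
Qed.

(** The first [t] steps act on the law and bring it within O(sqrt n) of [center] in mean square. The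
    other [s.+2] act on the indicator of an event: two smooth it, [s] contract its Lipschitz
    constant. *)
Lemma tv_upper (t s : nat) (x : 'I_M.+1) : lam ^+ (2 * t) * n%:R <= 1 ->
  tv_dist (delta_mx 0 x *m P ^+ (t + s.+2)) pi <=
    (8 / delta ^+ 6 + 24 / delta ^+ 4) * (delta^-1 + 4) / 2 * (1 - delta) ^+ s.
Proof.
move=> lamt; apply: tv_dist_le => A.
pose f : 'cV[R]_M.+1 := \col_y (y \in A)%:R.
have sumA (nu : 'rV[R]_M.+1) : \sum_(y in A) nu 0 y = (nu *m f) 0 0.
  rewrite mxE big_mkcond; apply: eq_bigr => y _; rewrite mxE.
  by case: (y \in A); rewrite ?mulr1 ?mulr0.
pose mu : 'rV[R]_M.+1 := delta_mx 0 x *m P ^+ t.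
pose g := P ^+ s *m (P *m (P *m f)).
have PE : P ^+ s.+2 *m f = g.
  by rewrite /g -addn2 exprD expr2 -!mulmxE !mulmxA.
have mud : is_dist mu by apply: is_dist_iter => //; exact: is_dist_delta.
have pid : is_dist pi by exact: (@bl_stationary_dist R n m r k).
have -> : \sum_(y in A) (delta_mx 0 x *m P ^+ (t + s.+2) : 'rV[R]_M.+1) 0 y = \sum_y mu 0 y * g y 0.
  have e : delta_mx 0 x *m P ^+ (t + s.+2) = mu *m P ^+ s.+2 by rewrite exprD mulmxA.
  by rewrite e sumA -mulmxA PE mxE.
have -> : \sum_(y in A) pi 0 y = \sum_y pi 0 y * g y 0.
  have e : pi *m P ^+ s.+2 = pi by exact: (@bl_stationary_iter R n m r k).
  by rewrite sumA -{1}e -mulmxA PE mxE.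
set C : R := 8 / delta ^+ 6 + _; have C0 : 0 <= C.
  by rewrite addr_ge0 // divr_ge0 // exprn_ge0 // ltW.
have f1 y : `|f y 0| <= 1 by rewrite mxE; case: (y \in A); rewrite ?normr1 ?normr0.
have Cw0 : 0 <= C / w by rewrite divr_ge0 // ltW.
have gL : lipschitz_col g ((1 - delta) ^+ s * (C / w)).
  by apply: lipschitz_iter => //; exact: lipschitz_two_steps.
have gB0 : 0 <= (1 - delta) ^+ s * (C / w) by rewrite mulr_ge0 // exprn_ge0.
rewrite (le_trans (lipschitz_expect_diff center mud pid gL gB0)) //.
have Qmu : sqdist mu center <= n%:R / delta + n%:R.
  have := @sqdist_iter R n m r k mr_n k0 km kn (delta_mx 0 x) t center (n%:R / delta).
  rewrite subrr mulr0 addr0 sqdist_delta => h.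
  apply: le_trans (h _ _ _ _) _ => //.
  - exact: is_dist_delta.
  - by rewrite divr_ge0 // ltW.
  - rewrite lerD2l.
    (* The start is at most [n] away, and [lam^(2t) n <= 1] turns [n^2] into [n]. *)
    have xc : (x%:R - center) ^+ 2 <= n%:R ^+ 2.
      rewrite -real_normK ?num_real // lerXn2r ?nnegrE // ler_norml.
      have xn : x%:R <= n%:R :> R by rewrite ler_nat; have := ltn_ord x; rewrite /M; nat_lia.
      have c0 : 0 <= center by rewrite divr_ge0 ?mulr_ge0.
      have cn : center <= n%:R.
        rewrite ler_pdivrMr // ler_pM // ler_nat; nat_lia.
      have x0 : 0 <= x%:R :> R by [].
      by apply/andP; split; lra.
    have l0 : 0 <= lam ^+ (2 * t) by rewrite exprM exprn_ge0 // sqr_ge0.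
    apply: le_trans (ler_wpM2l l0 xc) _.
    by rewrite expr2 mulrA ler_piMl.
have Qpi : sqdist pi center <= n%:R by exact: (@bl_stationary_sqdist R n m r k).
have D1 : \sum_x0 mu 0 x0 * `|x0%:R - center| <= w * (delta^-1 + 2) / 2.
  apply: le_trans (abs_dev_le center mud w0) _.
  rewrite ler_wpM2r ?invr_ge0 //.
  apply: le_trans (_ : (n%:R / delta + n%:R) / w + w <= _).
    by rewrite lerD2r ler_wpM2r // invr_ge0 ltW.
  by rewrite le_eqVlt; apply/orP; left; apply/eqP; rewrite -w2; field; rewrite !gt_eqF.
have D2 : \sum_x0 pi 0 x0 * `|x0%:R - center| <= w.
  apply: le_trans (abs_dev_le center pid w0) _.
  apply: le_trans (_ : (n%:R / w + w) / 2 <= _).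
    by rewrite ler_wpM2r ?invr_ge0 // lerD2r ler_wpM2r // invr_ge0 ltW.
  by rewrite le_eqVlt; apply/orP; left; apply/eqP; rewrite -w2; field; rewrite !gt_eqF.
apply: le_trans (ler_wpM2l gB0 (lerD D1 D2)) _.
rewrite le_eqVlt; apply/orP; left; apply/eqP.
by clearbody C; field; rewrite !gt_eqF.
Qed.

(** The mean from state 0 is still at distance [D] from [center], so being within [D / 2] of
    [center] separates the two laws. Chebyshev's inequality compares variances O(n) with
    [D^2 >= delta^4 Lam n]. *)
Lemma tv_lower (t : nat) (Lam : R) : 0 < Lam -> Lam <= lam ^+ (2 * t) * n%:R ->
  1 - 4 * (1 + delta^-1) / (delta ^+ 4 * Lam) <=
    tv_dist (delta_mx 0 ord0 *m P ^+ t) pi.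
Proof.
move=> Lam0 lamt.
pose mu : 'rV[R]_M.+1 := delta_mx 0 ord0 *m P ^+ t.
have mud : is_dist mu by apply: is_dist_iter => //; exact: is_dist_delta.
have pid : is_dist pi by exact: (@bl_stationary_dist R n m r k).
have c_ge : delta ^+ 2 * n%:R <= center.
  rewrite /center ler_pdivlMr // (_ : _ * _ * _ = delta * n%:R * (delta * n%:R)); last by ring.
  have dn : 0 <= delta * n%:R by rewrite mulr_ge0 // ltW.
  by rewrite ler_pM // (le_trans delta_k) // ler_nat.
have c0 : 0 < center by rewrite (lt_le_trans _ c_ge) // mulr_gt0 // exprn_gt0.
pose D := `|lam| ^+ t * center.
have D2 : delta ^+ 4 * Lam * n%:R <= D ^+ 2.
  rewrite /D exprMn -exprM mulnC exprM real_normK ?num_real // -exprM.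
  have l0 : 0 <= lam ^+ (2 * t) by rewrite exprM exprn_ge0 // sqr_ge0.
  apply: le_trans (_ : lam ^+ (2 * t) * (delta ^+ 2 * n%:R) ^+ 2 <= _); last first.
    apply: ler_wpM2l => //; rewrite lerXn2r ?nnegrE ?(ltW c0) //.
    by rewrite mulr_ge0 // exprn_ge0 // ltW.
  rewrite (_ : lam ^+ _ * _ = delta ^+ 4 * (lam ^+ (2 * t) * n%:R) * n%:R); last by ring.
  by rewrite ler_wpM2r // ler_wpM2l // exprn_ge0 // ltW.
have D20 : 0 < D ^+ 2 by rewrite (lt_le_trans _ D2) // !mulr_gt0 // exprn_gt0.
have D0 : 0 < D.
  rewrite lt_neqAle mulr_ge0 ?exprn_ge0 ?(ltW c0) // andbT eq_sym.
  by apply: contraTneq D20 => ->; rewrite expr0n ltxx.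
pose A : {set 'I_M.+1} := [set y : 'I_M.+1 | `|(y : nat)%:R - center| < D / 2]%SET.
have d20 : 0 < D / 2 by rewrite divr_gt0.
(* The mean at time [t] of the chain started at 0. *)
pose et := center + lam ^+ t * (0 - center).
have muA : \sum_(y in A) mu 0 y <= n%:R / delta / (D / 2) ^+ 2.
  apply: le_trans (chebyshev_dist (e := et) mud d20 _) _.
    move=> y; rewrite inE => yA.
    have -> : y%:R - et = lam ^+ t * center - (center - y%:R).
      by rewrite /et; ring.
    apply: le_trans (lerB_dist _ _).
    rewrite normrM normrX (gtr0_norm c0) -/D distrC lerBrDr.
    by rewrite {2}(splitr D) lerD2l ltW.
  rewrite ler_wpM2r ?invr_ge0 ?sqr_ge0 //.
  apply: le_trans (@sqdist_iter R n m r k mr_n k0 km kn (delta_mx 0 ord0) t 0 (n%:R / delta) _ _ _ _) _ => //.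
  - exact: is_dist_delta.
  - by rewrite divr_ge0 // ltW.
  - by rewrite sqdist_delta subrr expr0n mulr0 addr0.
have piA : 1 - n%:R / (D / 2) ^+ 2 <= \sum_(y in A) pi 0 y.
  rewrite -[X in X - _ <= _]pid.2 [X in X - _](bigID (mem A)) /= lerBlDr lerD2l.
  rewrite (eq_bigl (mem (~: A))) /=; last by move=> y; rewrite /= !inE.
  apply: le_trans (chebyshev_dist (e := center) pid d20 _) _.
    by move=> y; rewrite !inE -leNgt.
  by rewrite ler_wpM2r ?invr_ge0 ?sqr_ge0 // (@bl_stationary_sqdist R n m r k).
apply: le_trans (tv_dist_ge mu pi A).
rewrite distrC (le_trans _ (ler_norm _)) //.
apply: le_trans (lerB piA muA).
rewrite -addrA lerD2l -opprD lerN2 -mulrDl.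
have -> : (n%:R + n%:R / delta) / (D / 2) ^+ 2 = 4 * (1 + delta^-1) * (n%:R / D ^+ 2).
  by field; rewrite !gt_eqF.
rewrite ler_wpM2l ?mulr_ge0 ?addr_ge0 ?invr_ge0 ?(ltW delta0) //.
rewrite ler_pdivrMr // mulrC ler_pdivlMr 1?mulrC //.
by rewrite mulr_gt0 // exprn_gt0.
Qed.

End Quantitative.

(** * The cutoff time and constants uniform in the parameters *)

Section Cutoff.
Variable R : realType.

(** Taking logarithms: for [a] the eigenvalue, the cutoff time is where the squared displacement of
    the mean, of order [a^(2T) n^2], falls to the order n of the variance. *)
Lemma cutoff_time_le (a : R) (n T : nat) : 0 < `|a| -> `|a| < 1 -> (0 < n)%N ->
  (ln n%:R / (2 * `| ln `|a| |) <= T%:R) = (a ^+ (2 * T) * n%:R <= 1).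
Proof.
move=> a0 a1 n0; have nR0 : 0 < n%:R :> R by rewrite ltr0n.
have la : ln `|a| < 0 by rewrite ln_lt0 // a0.
rewrite (ltr0_norm la) ler_pdivrMr; last by rewrite mulr_gt0 // oppr_gt0.
have -> : a ^+ (2 * T) = `|a| ^+ (2 * T).
  by rewrite !exprM real_normK ?num_real.
rewrite -[RHS]ler_ln ?posrE ?mulr_gt0 ?exprn_gt0 // ln1 lnM ?posrE ?exprn_gt0 //.
have -> : ln (`|a| ^+ (2 * T)) = 2 * T%:R * ln `|a|.
  by rewrite lnXn // -[LHS]mulr_natl natrM.
rewrite -subr_le0.
by congr (_ <= _); ring.
Qed.

Lemma exists_geometric_le (delta K e : R) : 0 < delta -> delta <= 1 -> 0 < e ->
  exists s : nat, K * (1 - delta) ^+ s <= e.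
Proof.
move=> d0 d1 e0.
(* Bernoulli's inequality in a form without division. *)
have bern s : (1 - delta) ^+ s * (1 + s%:R * delta) <= 1.
  elim: s => [|s IH]; first by rewrite mul0r addr0 mulr1.
  apply: le_trans IH; rewrite exprSr -mulrA ler_wpM2l ?exprn_ge0 ?subr_ge0 //.
  rewrite -natr1; have : 0 <= s%:R :> R by []; move: s%:R => x x0; nra.
have [K0|K0] := leP K 0.
  by exists 0%N; rewrite mulr1 (le_trans K0) // ltW.
pose s := (Num.truncn (K / (e * delta))).+1; exists s.
have hs : K / (e * delta) < s%:R by exact: truncnS_gt.
have ed0 : 0 < e * delta by rewrite mulr_gt0.
rewrite ltr_pdivrMr // in hs.
have pos : 0 < 1 + s%:R * delta by rewrite ltr_wpDr // mulr_ge0 // ltW.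
rewrite -(ler_pM2r pos) -mulrA.
apply: le_trans (ler_wpM2l (ltW K0) (bern s)) _.
rewrite mulr1 mulrDr mulr1 (le_trans (ltW hs)) // mulrCA lerDr ltW //.
Qed.

Variables (delta eps : R).
Hypotheses (delta0 : 0 < delta) (delta1 : 2 * delta <= 1) (eps0 : 0 < eps) (eps1 : eps < 1).

(** The constants come from [delta] and [eps] alone, so in the theorem they can precede the
    sequences. *)
Lemma bl_cutoff_window : exists c C : R, forall n m r k : nat,
  (2 * r <= n)%N -> (2 * m <= n)%N -> (0 < k)%N -> (k <= m)%N ->
  delta * n%:R <= k%:R -> delta * n%:R <= r%:R ->
  k%:R + delta * n%:R <= (n - m)%:R ->
  1 - (k%:R * n%:R) / (m%:R * (n%:R - m%:R)) != 0 :> R ->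
  ((bl_cutoff_time R n m k - c)%:E <= bl_mixing_time n m r k eps)%E /\
  (bl_mixing_time n m r k eps <= (bl_cutoff_time R n m k + C)%:E)%E.
Proof.
have d1 : delta <= 1 by have := delta1; have := delta0; lra.
have d11 : delta < 1 by have := delta1; have := delta0; lra.
have e1 : 0 < 1 - eps by rewrite subr_gt0.
have [s hs] := exists_geometric_le
  ((8 / delta ^+ 6 + 24 / delta ^+ 4) * (delta^-1 + 4) / 2) delta0 d1 eps0.
(* The constant of [tv_lower]. The target [(1 - eps) / 2] below leaves a strict gap to [1 - eps]. *)
pose K := 4 * (1 + delta^-1) / delta ^+ 4.
have [c hc] := exists_geometric_le K delta0 d1 (divr_gt0 e1 (ltr0Sn R 1)).
(* Beyond [s], two steps are for smoothing and one for rounding the cutoff time up. *)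
exists c%:R, (s + 3)%:R => n m r k rn mn k0 km dk dr dn lam0.
have n0 : (0 < n)%N by nat_lia.
have m0 : (0 < m)%N by nat_lia.
have nR0 : 0 < n%:R :> R by rewrite ltr0n.
have kn : (k < n - m)%N.
  by rewrite -(ltr_nat R) (lt_le_trans _ dn) // ltrDl mulr_gt0.
pose lam : R := 1 - k%:R / m%:R - k%:R / (n - m)%:R.
have lamE : 1 - (k%:R * n%:R) / (m%:R * (n%:R - m%:R)) = lam.
  have m1 : m%:R != 0 :> R by rewrite pnatr_eq0 -lt0n.
  have nm1 : n%:R - m%:R != 0 :> R.
    by rewrite -natrB ?pnatr_eq0 -?lt0n; nat_lia.
  rewrite /lam natrB; last by nat_lia.
  by field; rewrite m1 nm1.
rewrite lamE in lam0.
have lam_gt0 : 0 < `|lam| by rewrite normr_gt0.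
have lam_le : `|lam| <= 1 - delta by exact: (bl_eigenvalue_le rn mn k0 km delta0 dk dn).
have lam_lt1 : `|lam| < 1 by rewrite (le_lt_trans lam_le) // gtrBl.
have tE (T : nat) : (bl_cutoff_time R n m k <= T%:R) = (lam ^+ (2 * T) * n%:R <= 1).
  by rewrite /bl_cutoff_time lamE cutoff_time_le.
have tn0 : 0 <= bl_cutoff_time R n m k.
  by rewrite /bl_cutoff_time divr_ge0 ?ln_ge0 ?ler1n // mulr_ge0.
split.
(* The start at 0 suffices. Mixing at some [t] more than [c] before the cutoff time would give
   [lam^(2(t+c)) n > 1], and [|lam| <= 1 - delta] then makes [lam^(2t) n] large enough for
   [tv_lower] to contradict it. *)
- apply: le_ereal_sup_tmp; exists (ereal_inf [set t%:R%:E | t in [set t : nat |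
      tv_dist (delta_mx 0 (ord0 : 'I_(minn m r).+1) *m bl_kernel R n m r k ^+ t)
              (bl_stationary R n m r) <= eps]]); first by exists ord0.
  apply: le_ereal_inf_tmp => _ [t tv <-]; rewrite lee_fin.
  rewrite leNgt; apply/negP => tlt.
  have := tE (t + c)%N; rewrite natrD leNgt -ltrBrDr tlt /= => /esym/negbT.
  rewrite -ltNge => lt1.
  have Lam0 : 0 < (1 - delta) ^- (2 * c) by rewrite invr_gt0 exprn_gt0 // subr_gt0.
  have lamt : (1 - delta) ^- (2 * c) <= lam ^+ (2 * t) * n%:R.
    rewrite -div1r ler_pdivrMr; last by rewrite exprn_gt0 // subr_gt0.
    apply: le_trans (ltW lt1) _.
    rewrite mulnDr exprD mulrAC ler_wpM2l //.
      by rewrite mulr_ge0 // exprM exprn_ge0 // sqr_ge0.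
    rewrite !exprM lerXn2r ?nnegrE ?sqr_ge0 //.
    by rewrite -[lam ^+ 2]real_normK ?num_real // lerXn2r ?nnegrE ?subr_ge0.
  have := le_trans (tv_lower rn mn k0 km delta0 dk dr dn Lam0 lamt) tv.
  rewrite invfM invrK mulrA -/K lerBlDr -lerBlDl => h.
  have : K * (1 - delta) ^+ (2 * c) <= (1 - eps) / 2.
    apply: le_trans hc; rewrite ler_wpM2l //.
      by rewrite /K !(mulr_ge0, invr_ge0, addr_ge0, exprn_ge0) // ltW.
    by apply: ler_wiXn2l; rewrite ?subr_ge0 ?gerBl ?(ltW delta0) //; nat_lia.
  by lra.
- apply: ge_ereal_sup => _ [x _ <-].
  pose t := (Num.truncn (bl_cutoff_time R n m k)).+1.
  have tt : bl_cutoff_time R n m k <= t%:R by apply/ltW; exact: truncnS_gt.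
  have tt2 : t%:R <= bl_cutoff_time R n m k + 1.
    by rewrite /t -natr1 lerD2r truncn_le.
  apply: ge_ereal_inf; exists (t + s.+2)%:R%:E.
    exists (t + s.+2)%N => //=.
    apply: le_trans hs; apply: (tv_upper (k := k) (delta := delta)) => //.
    by rewrite -/lam -tE.
  rewrite lee_fin natrD.
  have -> : (s + 3)%:R = 1 + s.+2%:R :> R by rewrite -[1 in RHS]/(1%:R) -natrD addnS addnC.
  by apply: le_trans (lerD tt2 (lexx _)) _; rewrite -addrA.
Qed.

End Cutoff.

(** * A common margin from the limits, valid for all large n *)

Theorem theorem1p4 (R : realType) (gamma h eta : R)
  (gamma_gt0 : 0 < gamma) (gamma_le_h : gamma <= h) (h_le_half : h <= 2^-1)
  (eta_gt0 : 0 < eta) (eta_le_half : eta <= 2^-1)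
  (gamma_neq : gamma <> h * (1 - h))
  (gamma_neq_half : h = 2^-1 -> gamma <> 2^-1)
  (eps : R) (eps_gt0 : 0 < eps) (eps_lt1 : eps < 1) :
  exists c C : R,
  forall m r k : nat -> nat,
    (\forall n \near \oo,
      [/\ (0 < m n)%N, (0 < r n)%N & (0 < k n)%N] /\
      [/\ (2 * r n <= n)%N, (2 * m n <= n)%N & (k n <= m n)%N]) ->
    ((k n)%:R / n%:R : R) @[n --> \oo] --> gamma ->
    ((m n)%:R / n%:R : R) @[n --> \oo] --> h ->
    ((r n)%:R / n%:R : R) @[n --> \oo] --> eta ->
    exists N1 N2 : nat,
      (forall n : nat, (N1 <= n)%N ->
        ((bl_cutoff_time R n (m n) (k n) - c)%:E
          <= bl_mixing_time n (m n) (r n) (k n) eps)%E) /\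
      (forall n : nat, (N2 <= n)%N ->
        (bl_mixing_time n (m n) (r n) (k n) eps
          <= (bl_cutoff_time R n (m n) (k n) + C)%:E)%E).
Proof.
have h0 : 0 < h by exact: lt_le_trans gamma_le_h.
have h1 : 0 < 1 - h by lra.
(* Equality would force [gamma = h = 1/2], the excluded case. *)
have gh : 0 < 1 - h - gamma.
  have [hh|hh] := eqVneq h 2^-1.
    have : gamma != 2^-1 by apply/eqP; exact: gamma_neq_half.
    by rewrite neq_lt => /orP[|]; lra.
  have : h < 2^-1 by rewrite lt_neqAle hh.
  lra.
(* Half of each limiting margin, so that the limits clear it strictly and the ratios do so
   eventually. *)
pose delta := Num.min (gamma / 2) (Num.min (eta / 2) ((1 - h - gamma) / 2)).
have delta0 : 0 < delta by rewrite /delta !lt_min !divr_gt0.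
have d_g : delta < gamma.
  have : delta <= gamma / 2 by rewrite /delta ge_min lexx.
  by lra.
have d_e : delta < eta.
  have : delta <= eta / 2 by rewrite /delta !ge_min lexx orbT.
  by lra.
have d_h : gamma + h < 1 - delta.
  have : delta <= (1 - h - gamma) / 2 by rewrite /delta !ge_min lexx !orbT.
  by lra.
have delta1 : 2 * delta <= 1.
  have : delta <= gamma / 2 by rewrite /delta ge_min lexx.
  by lra.
have [c [C cC]] := bl_cutoff_window delta0 delta1 eps_gt0 eps_lt1.
exists c, C => m r k ineqs kcvg mcvg rcvg.
(* The limiting eigenvalue vanishes only at [gamma = h (1 - h)]; hence the eigenvalue is nonzero for
   large n. *)
have lim_neq0 : 1 - gamma / (h * (1 - h)) != 0.
  rewrite subr_eq0 eq_sym; apply/eqP => e; apply: gamma_neq.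
  by rewrite -[LHS](@divfK _ (h * (1 - h))) ?e ?mul1r // mulf_neq0 // gt_eqF.
have lcvg : (1 - (k n)%:R / n%:R / ((m n)%:R / n%:R * (1 - (m n)%:R / n%:R)) : R)
    @[n --> \oo] --> 1 - gamma / (h * (1 - h)).
  apply: cvgB; first exact: cvg_cst.
  apply: cvgM => //; apply: cvgV; first by rewrite mulf_neq0 // gt_eqF.
  by apply: cvgM => //; apply: cvgB => //; exact: cvg_cst.
have kmcvg : ((k n)%:R / n%:R + (m n)%:R / n%:R : R) @[n --> \oo] --> gamma + h.
  exact: cvgD.
have k_ev : \forall n \near \oo, delta <= (k n)%:R / n%:R by exact: (cvgr_ge _ kcvg _ d_g).
have r_ev : \forall n \near \oo, delta <= (r n)%:R / n%:R by exact: (cvgr_ge _ rcvg _ d_e).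
have km_ev : \forall n \near \oo, (k n)%:R / n%:R + (m n)%:R / n%:R <= 1 - delta.
  exact: (cvgr_le _ kmcvg _ d_h).
have l_ev : \forall n \near \oo,
    1 - (k n)%:R / n%:R / ((m n)%:R / n%:R * (1 - (m n)%:R / n%:R)) != 0 :> R.
  exact: (cvgr_neq0 _ lcvg lim_neq0).
have [N _ HN] : \forall n \near \oo,
    ((bl_cutoff_time R n (m n) (k n) - c)%:E
       <= bl_mixing_time n (m n) (r n) (k n) eps)%E /\
    (bl_mixing_time n (m n) (r n) (k n) eps
       <= (bl_cutoff_time R n (m n) (k n) + C)%:E)%E.
  near=> n.
  have [[m0 r0 k0] [rn mn km]] :
      [/\ (0 < m n)%N, (0 < r n)%N & (0 < k n)%N] /\
      [/\ (2 * r n <= n)%N, (2 * m n <= n)%N & (k n <= m n)%N] by near: n.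
  have n0 : (0 < n)%N by nat_lia.
  have nR0 : 0 < n%:R :> R by rewrite ltr0n.
  have mn' : (m n <= n)%N by nat_lia.
  have mlt : (m n < n)%N by nat_lia.
  apply: cC => //.
  - rewrite -ler_pdivlMr //; near: n; exact: k_ev.
  - rewrite -ler_pdivlMr //; near: n; exact: r_ev.
  - have : (k n)%:R / n%:R + (m n)%:R / n%:R <= 1 - delta.
      by near: n; exact: km_ev.
    rewrite natrB // -mulrDl ler_pdivrMr // mulrBl mul1r; lra.
  - have -> : 1 - (k n)%:R * n%:R / ((m n)%:R * (n%:R - (m n)%:R)) =
        1 - (k n)%:R / n%:R / ((m n)%:R / n%:R * (1 - (m n)%:R / n%:R)) :> R.
      have mR0 : (m n)%:R != 0 :> R by rewrite pnatr_eq0 -lt0n.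
      have nm0 : n%:R - (m n)%:R != 0 :> R.
        by rewrite -natrB // pnatr_eq0 -lt0n subn_gt0.
      have nn0 : n%:R != 0 :> R by rewrite gt_eqF.
      by field; rewrite nn0 mR0 nm0.
    by near: n; exact: l_ev.
exists N, N; split=> n Nn; [exact: (HN n Nn).1|exact: (HN n Nn).2].
Unshelve. all: by end_near.
Qed.
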